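(* Let $V\subseteq\mathcal V$ be finite, $\mathbb E\in\mathit{NProg}(V)$, $W\subseteq\mathcal V$ finite, $P,Q$ projectors on $\mathcal H_W$, and $xp^p\in\{wp^p,wlp^p\}$. Then: (1) $sp^p.\mathbb E.(wlp^p.\mathbb E.Q)\sqsubseteq Q$ and $P\sqsubseteq wlp^p.\mathbb E.(sp^p.\mathbb E.P)$; (2) $wp^p.\mathbb E.Q=wlp^p.\mathbb E.Q\wedge wp^p.\mathbb E.I_W$; (3) $wp^p.\mathbb E.0=sp^p.\mathbb E.0=0$ and $wlp^p.\mathbb E.I_W=I_W$; (4) if $P\sqsubseteq Q$ then $xp^p.\mathbb E.P\sqsubseteq xp^p.\mathbb E.Q$ and $sp^p.\mathbb E.P\sqsubseteq sp^p.\mathbb E.Q$; (5) $xp^p.\mathbb E.(P\wedge Q)=xp^p.\mathbb E.P\wedge xp^p.\mathbb E.Q$; (6) $sp^p.\mathbb E.(P\wedge Q)\sqsubseteq sp^p.\mathbb E.P\wedge sp^p.\mathbb E.Q$; (7) $xp^p.\mathbb E.P\vee xp^p.\mathbb E.Q\sqsubseteq xp^p.\mathbb E.(P\vee Q)$; (8) $sp^p.\mathbb E.P\vee sp^p.\mathbb E.Q=sp^p.\mathbb E.(P\vee Q)$; (9) if $R$ is a projector on $\mathcal H_{W'}$ with $W'$ finite and $W'\cap(V\cup W)=\emptyset$, then $wp^p.\mathbb E.(Q\otimes R)=(wp^p.\mathbb E.Q)\otimes R$, $sp^p.\mathbb E.(P\otimes R)=(sp^p.\mathbb E.P)\otimes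 R$, and $wlp^p.\mathbb E.(Q\otimes R)\sqsupseteq(wlp^p.\mathbb E.Q)\otimes R$.
   Context: $\mathcal V$ is a countably infinite set of qubit variables; $\mathcal H_V=\bigotimes_{q\in V}\mathcal H_q$ with identity $I_V$. $\mathcal D(\mathcal H)$: partial density operators; projectors are identified with their image subspaces, ordered by inclusion $\sqsubseteq$; $\wedge$ intersection, $\vee$ span of union. $\mathit{DProg}(V)$: completely positive trace-nonincreasing super-operators on $\mathcal L(\mathcal H_V)$; $\mathit{NProg}(V)$: nonempty convex closed subsets of $\mathit{DProg}(V)$. Convention: operators/super-operators on subsystems are implicitly extended to larger systems by tensoring with identities; the transformers of a projector on a system $U$ are regarded as projectors on $\mathcal H_{V\cup U}$. For projectors $P,Q$ on $\mathcal H_U$: $\mathbb E\models_{tot}(\{P\},\{Q\})$ iff for all finite $X\supseteq V\cup U$ and $\rho\in\mathcal D(\mathcal H_X)$, ${\rm tr}(P\rho)\le\inf_{\mathcal E\in\mathbb E}{\rm tr}(Q\mathcal E(\rho))$; $\mathbb E\models_{par}(\{P\},\{Q\})$ iff for all such $X,\rho$, ${\rm tr}(P\rho)\le\inf_{\mathcal E\in\mathbb E}[{\rm tr}(Q\mathcal E(\rho))+{\rm tr}(\rho)-{\rm tr}(\mathcal E(\rho))]$. $wp^p.\mathbb E.Q$ is the largest projector $P$ with $\mathbb E\models_{tot}(\{P\},\{Q\})$; $wlp^p.\mathbb E.Q$ the largest projector $P$ with $\mathbb E\models_{par}(\{P\},\{Q\})$; $sp^p.\mathbb E.P$ the smallest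 projector $R$ with $\mathbb E\models_{par}(\{P\},\{R\})$. *)

(* Defs.v *)
From mathcomp Require Import all_boot all_order all_algebra finmap.
From mathcomp Require Import reals complex.
From Stdlib Require Import ClassicalEpsilon.
Import GRing.Theory Num.Theory.

Set Implicit Arguments.
Unset Strict Implicit.
Unset Printing Implicit Defensive.

Local Open Scope fset_scope.
Local Open Scope ring_scope.

(* Computational basis of H_X : a basis state |s> of the qubits in X is
   identified with the set s of those qubits of X that are in state |1>. *)
Notation st X := {set (fset_sub_type X)}.

(* vectors of H_X and operators in L(H_X) (as matrices in the computational
   basis), with complex entries [R[i]] over a real field [R : realType]. *)
Definition vec (R : realType) (X : {fset nat}) := st X -> R[i].
Definition op (R : realType) (X : {fset nat}) := st X -> st X -> R[i].
Definition sop (R : realType) (X : {fset nat}) := op R X -> op R X.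

Definition memb (X : {fset nat}) (s : st X) (q : nat) : bool :=
  [exists x in s, val x == q].
Definition restr (Y X : {fset nat}) (s : st X) : st Y :=
  [set y : fset_sub_type Y | memb s (val y)].
Arguments restr Y {X} s.
Definition join (V X : {fset nat}) (u : st V) (s : st X) : st X :=
  [set x : fset_sub_type X |
     if val x \in V then memb u (val x) else memb s (val x)].
Definition agree_off (X : {fset nat}) {Y : {fset nat}} (s t : st Y) : bool :=
  [forall y : fset_sub_type Y, (val y \notin X) ==> (memb s (val y) == memb t (val y))].

Definition zop (R : realType) (X : {fset nat}) : op R X := fun _ _ => 0.
Definition idop (R : realType) (X : {fset nat}) : op R X := fun s t => (s == t)%:R.
Arguments zop R X : clear implicits.
Arguments idop R X : clear implicits.

(* A regarded as an operator on H_Y (X subset of Y): A (x) I_{Y \ X} *)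
Definition ext (R : realType) (X : {fset nat}) (Y : {fset nat}) (A : op R X) : op R Y :=
  fun s t => A (restr X s) (restr X t) * (agree_off X s t)%:R.
Arguments ext {R X} Y A.

(* tensor product A (x) B of operators on disjoint systems X and Y *)
Definition tens (R : realType) (X Y : {fset nat}) (A : op R X) (B : op R Y)
  : op R (X `|` Y) :=
  fun s t => A (restr X s) (restr X t) * B (restr Y s) (restr Y t).

Definition mulo (R : realType) (I : finType) (A B : I -> I -> R[i]) : I -> I -> R[i] :=
  fun s t => \sum_u A s u * B u t.
Definition appv (R : realType) (I : finType) (A : I -> I -> R[i]) (v : I -> R[i]) : I -> R[i] :=
  fun s => \sum_t A s t * v t.
Definition adj (R : realType) (I : finType) (A : I -> I -> R[i]) : I -> I -> R[i] :=
  fun s t => (A t s)^*.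
Definition tr (R : realType) (I : finType) (A : I -> I -> R[i]) : R[i] :=
  \sum_s A s s.
(* positive semidefinite: <v|A|v> >= 0 (real and nonnegative) for all v *)
Definition psd (R : realType) (I : finType) (A : I -> I -> R[i]) : Prop :=
  forall v : I -> R[i], 0 <= \sum_s \sum_t (v s)^* * A s t * v t.

Definition pdens (R : realType) (X : {fset nat}) (rho : op R X) : Prop :=
  psd rho /\ tr rho <= 1.

Definition is_proj (R : realType) (X : {fset nat}) (P : op R X) : Prop :=
  mulo P P = P /\ adj P = P.
Definition image (R : realType) (X : {fset nat}) (P : op R X) : vec R X -> Prop :=
  fun v => exists w, v = appv P w.
Definition psub (R : realType) (X : {fset nat}) (P Q : op R X) : Prop :=
  forall v, image P v -> image Q v.
(* ⊑ and = between operators on possibly different systems X and Y: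
   both are regarded as operators on X ∪ Y (tensoring with identities) *)
Definition ple (R : realType) (X Y : {fset nat}) (P : op R X) (Q : op R Y) : Prop :=
  psub (ext (X `|` Y) P) (ext (X `|` Y) Q).
Definition peq (R : realType) (X Y : {fset nat}) (P : op R X) (Q : op R Y) : Prop :=
  ext (X `|` Y) P = ext (X `|` Y) Q.

Lemma op_inhabited (R : realType) (X : {fset nat}) : inhabited (op R X).
Proof. exact (inhabits (zop R X)). Qed.

Definition pmeet (R : realType) (X : {fset nat}) (P Q : op R X) : op R X :=
  epsilon (op_inhabited R X)
    (fun M => is_proj M /\ forall v, image M v <-> (image P v /\ image Q v)).
Definition pjoin (R : realType) (X : {fset nat}) (P Q : op R X) : op R X :=
  epsilon (op_inhabited R X)
    (fun M => is_proj M /\ forall v, image M v <->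
       (exists a b, image P a /\ image Q b /\ v = (fun s => a s + b s))).

Definition sop_linear (R : realType) (V : {fset nat}) (E : sop R V) : Prop :=
  forall (c : R[i]) (A B : op R V),
    E (fun s t => c * A s t + B s t) = (fun s t => c * E A s t + E B s t).
(* E (x) id_T on L(H_V (x) C^T), for an arbitrary finite ancilla index type T *)
Definition sop_anc (R : realType) (V : {fset nat}) (T : finType) (E : sop R V)
  (rho : (st V * T)%type -> (st V * T)%type -> R[i]) :
  (st V * T)%type -> (st V * T)%type -> R[i] :=
  fun x y => E (fun u w => rho (u, x.2) (w, y.2)) x.1 y.1.
Definition completely_positive (R : realType) (V : {fset nat}) (E : sop R V) : Prop :=
  forall (T : finType) (rho : (st V * T)%type -> (st V * T)%type -> R[i]),
    psd rho -> psd (sop_anc E rho).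
Definition trace_nonincreasing (R : realType) (V : {fset nat}) (E : sop R V) : Prop :=
  forall rho : op R V, psd rho -> tr (E rho) <= tr rho.
Definition DProg (R : realType) (V : {fset nat}) (E : sop R V) : Prop :=
  [/\ sop_linear E, completely_positive E & trace_nonincreasing E].

Definition ccvg (R : realType) (u : nat -> R[i]) (l : R[i]) : Prop :=
  forall eps : R[i], 0 < eps -> exists N, forall n, (N <= n)%N -> `|u n - l| < eps.

Definition NProg (R : realType) (V : {fset nat}) (S : sop R V -> Prop) : Prop :=
  [/\ exists E, S E,
      forall E, S E -> DProg E,
      (forall E1 E2 (l : R[i]), S E1 -> S E2 -> 0 <= l -> l <= 1 ->
         S (fun rho s t => l * E1 rho s t + (1 - l) * E2 rho s t)) &
      (forall (f : nat -> sop R V) (E0 : sop R V), (forall n, S (f n)) ->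
         (forall rho s t, ccvg (fun n => f n rho s t) (E0 rho s t)) -> S E0)].

(* E(rho) for rho on a larger system X ⊇ V : (E (x) id_{X \ V})(rho) *)
Definition sapp (R : realType) (V X : {fset nat}) (E : sop R V) (rho : op R X) : op R X :=
  fun s t => E (fun u w => rho (join u s) (join w t)) (restr V s) (restr V t).

(* inf_{E in S} f(E) >= a is written (equivalently) as: forall E in S, f(E) >= a *)
Definition sat_tot (R : realType) (V U1 U2 : {fset nat}) (S : sop R V -> Prop)
  (P : op R U1) (Q : op R U2) : Prop :=
  forall X : {fset nat}, V `|` U1 `|` U2 `<=` X ->
  forall rho : op R X, pdens rho ->
  forall E, S E -> tr (mulo (ext X P) rho) <= tr (mulo (ext X Q) (sapp E rho)).

Definition sat_par (R : realType) (V U1 U2 : {fset nat}) (S : sop R V -> Prop)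
  (P : op R U1) (Q : op R U2) : Prop :=
  forall X : {fset nat}, V `|` U1 `|` U2 `<=` X ->
  forall rho : op R X, pdens rho ->
  forall E, S E -> tr (mulo (ext X P) rho) <=
     tr (mulo (ext X Q) (sapp E rho)) + tr rho - tr (sapp E rho).

Definition wp (R : realType) (V W : {fset nat}) (S : sop R V -> Prop) (Q : op R W)
  : op R (V `|` W) :=
  epsilon (op_inhabited R (V `|` W)) (fun P => [/\ is_proj P, sat_tot S P Q &
     forall P', is_proj P' -> sat_tot S P' Q -> psub P' P]).
Definition wlp (R : realType) (V W : {fset nat}) (S : sop R V -> Prop) (Q : op R W)
  : op R (V `|` W) :=
  epsilon (op_inhabited R (V `|` W)) (fun P => [/\ is_proj P, sat_par S P Q &
     forall P', is_proj P' -> sat_par S P' Q -> psub P' P]).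
Definition sp (R : realType) (V W : {fset nat}) (S : sop R V -> Prop) (P : op R W)
  : op R (V `|` W) :=
  epsilon (op_inhabited R (V `|` W)) (fun Q => [/\ is_proj Q, sat_par S P Q &
     forall Q', is_proj Q' -> sat_par S P Q' -> psub Q Q']).

(* Main.v *)
Require Import Defs.
From mathcomp Require Import all_boot all_order all_algebra finmap.
From mathcomp Require Import reals complex ring.
From Stdlib Require Import FunctionalExtensionality Classical ClassicalEpsilon.
Import Order.TTheory GRing.Theory Num.Theory.
Import Defs.
Local Open Scope fset_scope.
Local Open Scope ring_scope.
Set Implicit Arguments.
Unset Strict Implicit.
Unset Printing Implicit Defensive.

(** Both correctness notions say that a positive linear functional of the input, bounded by
    the trace, is dominated by [tr ((I - P) rho)]: for partial correctness it is
    [tr ((I - Q) E(rho))], for total correctness [tr rho - tr (Q E(rho))].  Since positive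
    operators are sums of rank-one ones and null vectors of a positive form lie in its radical,
    the domination holds iff the functional vanishes on [|v><v|] for every [v] in the image of
    [P].  The vectors on which it vanishes form a subspace that is computed slice by slice on
    larger systems.  Hence [wlp E Q] projects onto the [v] such that the range of every
    [E(|v><v|)] lies in the image of [Q], [wp E Q] requires in addition that the trace be
    preserved, and [sp E P] projects onto the span of the ranges of all [E(|v><v|)] with [v] in
    the image of [P].  All nine items follow by comparing images; for the tensor products one
    uses that [R] acts on a system disjoint from that of [E] and so commutes with [E]. *)

(** * Linear algebra over a finite index set *)

Definition outer (R : realType) (I : finType) (v w : I -> R[i]) : I -> I -> R[i] :=
  fun s t => v s * (w t)^*.

Definition lincomb (R : realType) (I : Type) (c : R[i]) (v w : I -> R[i]) : I -> R[i] :=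
  fun s => c * v s + w s.

Definition subspace (R : realType) (I : Type) (L : (I -> R[i]) -> Prop) : Prop :=
  L (fun=> 0) /\ forall c v w, L v -> L w -> L (lincomb c v w).

Definition linear_form (R : realType) (I : Type) (h : (I -> I -> R[i]) -> R[i]) : Prop :=
  forall c A B, h (fun s t => c * A s t + B s t) = c * h A + h B.

(** The form [<v|A|w>], antilinear in [v]; [psd A] unfolds to [0 <= herm A v v] for every [v]. *)
Definition herm (R : realType) (I : finType) (A : I -> I -> R[i]) (v w : I -> R[i]) : R[i] :=
  \sum_s \sum_t (v s)^* * A s t * w t.

Definition compl (R : realType) (X : {fset nat}) (P : op R X) : op R X :=
  fun s t => idop R X s t - P s t.

Lemma op_ext (R : realType) (I J : Type) (A B : I -> J -> R[i]) :
  (forall s t, A s t = B s t) -> A = B.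
Proof.
by move=> AB; apply: functional_extensionality => s;
   apply: functional_extensionality => t.
Qed.

Lemma vec_ext (R : realType) (I : Type) (v w : I -> R[i]) : (forall s, v s = w s) -> v = w.
Proof. by move=> vw; apply: functional_extensionality. Qed.

Lemma sum_delta (R : realType) (I : finType) (i : I) (f : I -> R[i]) :
  \sum_j (i == j)%:R * f j = f i.
Proof.
rewrite (bigD1 i) //= eqxx mul1r big1 ?addr0 // => j /negbTE.
by rewrite eq_sym => ->; rewrite mul0r.
Qed.

Lemma appv_lincomb (R : realType) (I : finType) (A : I -> I -> R[i]) c v w :
  appv A (lincomb c v w) = lincomb c (appv A v) (appv A w).
Proof.
apply: vec_ext => s; rewrite /appv /lincomb mulr_sumr -big_split /=.
by apply: eq_bigr => t _; ring.
Qed.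

Lemma appv0 (R : realType) (I : finType) (A : I -> I -> R[i]) :
  appv A (fun=> 0) = fun=> 0.
Proof. by apply: vec_ext => s; apply: big1 => t _; rewrite mulr0. Qed.

Lemma appv_mulo (R : realType) (I : finType) (A B : I -> I -> R[i]) v :
  appv (mulo A B) v = appv A (appv B v).
Proof.
apply: vec_ext => s; rewrite /appv /mulo.
under eq_bigr do rewrite mulr_suml.
rewrite exchange_big; apply: eq_bigr => u _; rewrite mulr_sumr.
by apply: eq_bigr => t _; rewrite mulrA.
Qed.

Lemma appv_ket (R : realType) (I : finType) (A : I -> I -> R[i]) i :
  appv A (fun t => (i == t)%:R) = A^~ i.
Proof.
apply: vec_ext => s; rewrite /appv -[RHS](sum_delta i (A s)).
by apply: eq_bigr => t _; rewrite mulrC.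
Qed.

Lemma muloA (R : realType) (I : finType) (A B D : I -> I -> R[i]) :
  mulo A (mulo B D) = mulo (mulo A B) D.
Proof.
by apply: op_ext => s t; have /(congr1 (fun f => f s)) := appv_mulo A B (D^~ t).
Qed.

Lemma adj_mulo (R : realType) (I : finType) (A B : I -> I -> R[i]) :
  adj (mulo A B) = mulo (adj B) (adj A).
Proof.
apply: op_ext => s t; rewrite /adj /mulo rmorph_sum /=.
by apply: eq_bigr => u _; rewrite rmorphM mulrC.
Qed.

Lemma tr_mulo (R : realType) (I : finType) (A B : I -> I -> R[i]) :
  tr (mulo A B) = tr (mulo B A).
Proof.
rewrite /tr /mulo exchange_big; apply: eq_bigr => s _; apply: eq_bigr => t _.
by rewrite mulrC.
Qed.

Lemma mul1o (R : realType) (X : {fset nat}) (A : op R X) : mulo (idop R X) A = A.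
Proof. by apply: op_ext => s t; rewrite /mulo /idop sum_delta. Qed.

Lemma app1v (R : realType) (X : {fset nat}) (v : vec R X) : appv (idop R X) v = v.
Proof. by apply: vec_ext => s; rewrite /appv /idop sum_delta. Qed.

Lemma proj_idop (R : realType) (X : {fset nat}) : is_proj (idop R X).
Proof.
split; first exact: mul1o.
by apply: op_ext => s t; rewrite /adj /idop eq_sym rmorph_nat.
Qed.

Lemma image_idop (R : realType) (X : {fset nat}) (v : vec R X) : image (idop R X) v.
Proof. by exists v; rewrite app1v. Qed.

Lemma app0v (R : realType) (X : {fset nat}) (v : vec R X) : appv (zop R X) v = fun=> 0.
Proof. by apply: vec_ext => s; apply: big1 => t _; rewrite mul0r. Qed.

Lemma proj_zop (R : realType) (X : {fset nat}) : is_proj (zop R X).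
Proof.
split; apply: op_ext => s t; last by rewrite /adj /zop rmorph0.
by apply: big1 => u _; rewrite mul0r.
Qed.

Lemma image_zop (R : realType) (X : {fset nat}) (v : vec R X) :
  image (zop R X) v -> v = fun=> 0.
Proof. by case=> w ->; rewrite app0v. Qed.

Lemma proj_imageP (R : realType) (X : {fset nat}) (P : op R X) v :
  is_proj P -> image P v <-> appv P v = v.
Proof.
case=> PP _; split=> [[w ->]|<-]; last by exists v.
by rewrite -appv_mulo PP.
Qed.

Lemma image_appv (R : realType) (X : {fset nat}) (P : op R X) v : image P (appv P v).
Proof. by exists v. Qed.

Lemma image_subspace (R : realType) (X : {fset nat}) (P : op R X) : subspace (image P).
Proof.
split; first by exists (fun=> 0); rewrite appv0.
by move=> c _ _ [v ->] [w ->]; exists (lincomb c v w); rewrite appv_lincomb.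
Qed.

Lemma subspace_sum (R : realType) (I : Type) (J : finType) (L : (I -> R[i]) -> Prop)
    (c : J -> R[i]) (v : J -> I -> R[i]) :
  subspace L -> (forall j, L (v j)) -> L (fun s => \sum_j c j * v j s).
Proof.
move=> [L0 LD] Lv; elim: (index_enum J) => [|j r IH].
  by rewrite (_ : (fun _ => _) = fun=> 0) //; apply: vec_ext => s; rewrite big_nil.
rewrite (_ : (fun _ => _) = lincomb (c j) (v j) (fun s => \sum_(k <- r) c k * v k s)).
  exact: LD.
by apply: vec_ext => s; rewrite big_cons.
Qed.

Lemma subspace_image (R : realType) (X : {fset nat}) (P : op R X) L :
  subspace L -> (forall t, L (P^~ t)) -> forall v, image P v -> L v.
Proof.
move=> sL LP _ [w ->].
rewrite (_ : appv P w = fun s => \sum_t w t * P s t); first exact: subspace_sum.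
by apply: vec_ext => s; apply: eq_bigr => t _; rewrite mulrC.
Qed.

Lemma image_col (R : realType) (X : {fset nat}) (P : op R X) t : image P (P^~ t).
Proof. by rewrite -appv_ket; apply: image_appv. Qed.

(** [Q] fixes its image pointwise, and the columns of [P] lie in [image P]. *)
Lemma psub_mulo (R : realType) (X : {fset nat}) (P Q : op R X) :
  is_proj Q -> psub P Q <-> mulo Q P = P.
Proof.
move=> pQ; split=> [PQ|QP _ [v ->]]; last by rewrite -QP appv_mulo; apply: image_appv.
apply: op_ext => s t; have /proj_imageP -/(_ pQ)/(congr1 (fun f => f s)) //= := PQ _ (image_col P t).
Qed.

(** One inclusion gives [Q P = P], whose adjoint is [P Q = P]; the other gives [P Q = Q]. So a
    self-adjoint projector is determined by its image. *)
Lemma proj_anti (R : realType) (X : {fset nat}) (P Q : op R X) :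
  is_proj P -> is_proj Q -> psub P Q -> psub Q P -> P = Q.
Proof.
move=> pP pQ /(psub_mulo _ pQ) QP /(psub_mulo _ pP) PQ.
case: pP pQ => _ aP [_ aQ].
by rewrite -[LHS]aP -QP adj_mulo aP aQ PQ.
Qed.

Lemma proj_eq (R : realType) (X : {fset nat}) (P Q : op R X) :
  is_proj P -> is_proj Q -> (forall v, image P v <-> image Q v) -> P = Q.
Proof. by move=> pP pQ PQ; apply: proj_anti => // v /PQ. Qed.

Lemma appv_compl (R : realType) (X : {fset nat}) (P : op R X) v :
  appv (compl P) v = fun s => v s - appv P v s.
Proof.
apply: vec_ext => s.
transitivity (appv (idop R X) v s - appv P v s); last by rewrite app1v.
rewrite /appv -sumrB.
by apply: eq_bigr => t _; rewrite mulrBl.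
Qed.

Lemma mulo_compl (R : realType) (X : {fset nat}) (P A : op R X) :
  mulo (compl P) A = fun s t => A s t - mulo P A s t.
Proof.
apply: op_ext => s t; have /(congr1 (fun f => f s)) := appv_compl P (A^~ t).
by [].
Qed.

Lemma proj_compl (R : realType) (X : {fset nat}) (P : op R X) :
  is_proj P -> is_proj (compl P).
Proof.
case=> PP aP; split; apply: op_ext => s t.
  rewrite mulo_compl /compl -[X in _ - X = _]/(mulo P (compl P) s t).
  have -> : mulo P (compl P) s t = P s t - mulo P P s t.
    rewrite -[P s t]/((P^~ t) s) -appv_ket /appv /mulo -sumrB; apply: eq_bigr => u _.
    by rewrite /compl /idop eq_sym; ring.
  by rewrite PP subrr subr0.
rewrite /adj /compl rmorphB /= -[(P t s)^*]/(adj P s t) aP.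
by rewrite /idop rmorph_nat eq_sym.
Qed.

Lemma tr_compl (R : realType) (X : {fset nat}) (P A : op R X) :
  tr (mulo (compl P) A) = tr A - tr (mulo P A).
Proof. by rewrite mulo_compl /tr sumrB. Qed.

(* Evaluating at real multiples of [t] forces [t * x + t^* * y = 0] for every [t]. *)
Lemma null_of_affine_ge0 (R : realType) (c x y : R[i]) :
  (forall t : R[i], 0 <= c + t * x + t^* * y) -> x = 0 /\ y = 0.
Proof.
move=> H.
have c0 : 0 <= c by have := H 0; rewrite rmorph0 !mul0r !addr0.
have Z t : t * x + t^* * y = 0.
  set z := _ + _.
  have Hr (r : R[i]) : 0 <= r -> 0 <= c + r * z /\ 0 <= c - r * z.
    move=> r0; have rr : r^* = r by exact: geC0_conj.
    split.
      by have := H (r * t); rewrite rmorphM /= rr /z mulrDr !mulrA addrA.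
    have := H (- (r * t)); rewrite rmorphN rmorphM /= rr /z mulrDr !mulrA opprD addrA.
    by rewrite !mulNr.
  have zr : z \is Num.real.
    have [h1 _] := Hr 1 ler01; rewrite mul1r in h1.
    by rewrite -[z](addKr c) rpredD ?rpredN ?ger0_real.
  have cp : 0 <= c + 1 by rewrite addr_ge0.
  (* For nonzero [z], the choice [r = (c + 1) / |z|] makes one of [c + r z] and [c - r z] equal to
     [-1]. *)
  have [h1 h2] := Hr ((c + 1) * `|z|^-1) (mulr_ge0 cp (etrans (invr_ge0 _) (normr_ge0 _))).
  apply/eqP/negPn/negP => zn; have nzn : `|z| != 0 by rewrite normr_eq0.
  have [zp|zneg] := real_ge0P zr.
    move: h2; rewrite (ger0_norm zp) -mulrA mulVf // mulr1 opprD addrA subrr sub0r.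
    by rewrite oppr_ge0 ler10.
  move: h1; rewrite (ltr0_norm zneg) invrN mulrN mulNr -mulrA mulVf // mulr1.
  by rewrite opprD addrA subrr sub0r oppr_ge0 ler10.
(* [t = 1] gives [x = - y], and then [t = 'i] gives [y = 0]. *)
have := Z 1; rewrite rmorph1 !mul1r => /eqP; rewrite addr_eq0 => /eqP xy.
have := Z 'i; rewrite conjCi xy mulrN mulNr -opprD => /eqP; rewrite oppr_eq0 -mulrDr.
rewrite mulf_eq0 (negbTE (neq0Ci _)) /= -mulr2n mulrn_eq0 /= => /eqP y0.
by rewrite y0 oppr0.
Qed.

(** * Positive forms, their radical and their rank-one decomposition *)

Lemma hermE (R : realType) (I : finType) (A : I -> I -> R[i]) v w :
  herm A v w = \sum_s (v s)^* * appv A w s.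
Proof.
apply: eq_bigr => s _; rewrite /appv mulr_sumr; apply: eq_bigr => t _.
by rewrite mulrA.
Qed.

Lemma herm_lincomb (R : realType) (I : finType) (A : I -> I -> R[i]) c v w :
  herm A (lincomb c v w) (lincomb c v w) =
  herm A w w + c * herm A w v + c^* * herm A v w + c^* * c * herm A v v.
Proof.
rewrite /herm !mulr_sumr -!big_split; apply: eq_bigr => s _ /=.
rewrite !mulr_sumr -!big_split; apply: eq_bigr => t _ /=.
by rewrite /lincomb rmorphD rmorphM /=; ring.
Qed.

(** As [herm A v v] vanishes, the nonnegative value of the form at [t v + w] has no quadratic term
    in [t], so both cross terms are zero. *)
Lemma psd_null (R : realType) (I : finType) (A : I -> I -> R[i]) v :
  psd A -> herm A v v = 0 ->
  (forall w, herm A w v = 0) /\ (forall w, herm A v w = 0).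
Proof.
move=> pA v0.
suff H w : herm A w v = 0 /\ herm A v w = 0 by split=> w; case: (H w).
apply: (@null_of_affine_ge0 _ (herm A w w)) => t.
by have := pA (lincomb t v w); rewrite -/(herm _ _ _) herm_lincomb v0 mulr0 addr0.
Qed.

(** Idempotence and cyclicity turn the trace into that of [Q A Q], which exhibits it as a sum of
    values of the form of [A]. *)
Lemma tr_proj_mulo (R : realType) (X : {fset nat}) (Q A : op R X) :
  is_proj Q -> tr (mulo Q A) = \sum_i herm A (Q^~ i) (Q^~ i).
Proof.
case=> QQ aQ; rewrite -{1}QQ -muloA tr_mulo -muloA /tr; apply: eq_bigr => i _.
rewrite hermE; apply: eq_bigr => s _.
by rewrite -{1}aQ.
Qed.

Lemma tr_proj_psd (R : realType) (X : {fset nat}) (Q A : op R X) :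
  is_proj Q -> psd A -> 0 <= tr (mulo Q A).
Proof. by move=> pQ pA; rewrite tr_proj_mulo // sumr_ge0 // => i _; apply: pA. Qed.

(** Each summand of [tr_proj_mulo] is nonnegative, hence zero, so every column of [Q] lies in the
    radical of [A]. Since [Q] is self-adjoint, this says [Q A = 0]. *)
Lemma tr_proj_psd_eq0 (R : realType) (X : {fset nat}) (Q A : op R X) :
  is_proj Q -> psd A -> tr (mulo Q A) = 0 -> forall v, appv Q (appv A v) = fun=> 0.
Proof.
move=> pQ pA; case: (pQ) => _ aQ.
rewrite tr_proj_mulo // => /eqP; rewrite psumr_eq0; last first.
  by move=> i _; apply: pA.
move=> /allP h v; apply: vec_ext => i.
have /eqP/(psd_null pA)[_ /(_ v)] : herm A (Q^~ i) (Q^~ i) == 0 by apply: h; rewrite mem_index_enum.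
rewrite hermE => <-; apply: eq_bigr => s _; congr (_ * _).
by rewrite -{1}aQ.
Qed.

(** Polarization: a positive form has real diagonal values, so [t x + t^* y] is real for every [t];
    [t = 1] and [t = 'i] then force [y] to be the conjugate of [x]. *)
Lemma psd_conj (R : realType) (I : finType) (A : I -> I -> R[i]) v w :
  psd A -> (herm A w v)^* = herm A v w.
Proof.
move=> pA; set x := herm A w v; set y := herm A v w.
have H t : (t * x + t^* * y) \is Num.real.
  have -> : t * x + t^* * y =
      herm A (lincomb t v w) (lincomb t v w) - herm A w w - t^* * t * herm A v v.
    by rewrite herm_lincomb /x /y; ring.
  have hr u : herm A u u \is Num.real by apply: ger0_real; apply: pA.
  have tr : t^* * t \is Num.real by rewrite ger0_real // mulrC mul_conjC_ge0.
  by apply: rpredB (rpredM tr (hr v)); apply: rpredB.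
have /CrealP := H 1; have /CrealP := H 'i.
rewrite conjCi rmorph1 !mul1r !rmorphD !rmorphM !rmorphN /= !conjCi opprK => h1 h2.
have h3 : 'i * (y^* - x^* - (x - y)) = 0 :> R[i].
  by rewrite -[RHS](subrr ('i * x + - 'i * y)) -{1}h1; ring.
move/eqP: h3; rewrite mulf_eq0 (negbTE (neq0Ci _)) /= => /eqP h3.
have : x^* *+ 2 - y *+ 2 = 0.
  rewrite -[RHS](subrr (x + y)) -{1}h2 -[LHS]addr0 -h3; ring.
by rewrite -mulrnBl => /eqP; rewrite mulrn_eq0 /= subr_eq0 => /eqP.
Qed.

Lemma herm_ketl (R : realType) (I : finType) (A : I -> I -> R[i]) i v :
  herm A (fun t => (i == t)%:R) v = appv A v i.
Proof.
rewrite hermE -[RHS](sum_delta i); apply: eq_bigr => s _.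
by rewrite rmorph_nat.
Qed.

Lemma herm_ket (R : realType) (I : finType) (A : I -> I -> R[i]) i j :
  herm A (fun t => (i == t)%:R) (fun t => (j == t)%:R) = A i j.
Proof. by rewrite herm_ketl appv_ket. Qed.

Lemma psd_entry_conj (R : realType) (I : finType) (A : I -> I -> R[i]) i j :
  psd A -> (A i j)^* = A j i.
Proof. by move=> pA; rewrite -2!herm_ket; apply: psd_conj. Qed.

Lemma psd_diag_ge0 (R : realType) (I : finType) (A : I -> I -> R[i]) i :
  psd A -> 0 <= A i i.
Proof. by move=> pA; rewrite -herm_ket; apply: pA. Qed.

Lemma linear_form0 (R : realType) (I : finType) (h : (I -> I -> R[i]) -> R[i]) :
  linear_form h -> h (fun _ _ => 0) = 0.
Proof.
move=> lh; have := lh 1 (fun _ _ => 0) (fun _ _ => 0).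
rewrite (_ : (fun _ _ => 1 * 0 + 0) = fun _ _ => 0); last first.
  by apply: op_ext => s t; rewrite mulr0 addr0.
by move/esym/eqP; rewrite mul1r -subr_eq0 addrK => /eqP.
Qed.

(* The Schur complement of a nonzero diagonal entry kills that entry and no other one
   revives, so a positive matrix is a finite sum of rank-one ones. *)
Lemma linear_form_psd_ge0 (R : realType) (I : finType) (h : (I -> I -> R[i]) -> R[i]) :
  linear_form h -> (forall v, 0 <= h (outer v v)) -> forall A, psd A -> 0 <= h A.
Proof.
move=> lh h0 A; have [n] := ubnP #|[set s | A s s != 0]|.
elim: n A => // n IH A ltn pA.
have [/existsP[i Ai]|/existsPn A0] := boolP [exists i, A i i != 0]; last first.
  (* With a zero diagonal every basis vector is null, hence in the radical, and all entries
     vanish. *)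
  rewrite (_ : A = fun _ _ => 0) ?linear_form0 //; apply: op_ext => s t.
  have /negPn/eqP := A0 s; rewrite -herm_ket => /(psd_null pA)[_ /(_ (fun u => (t == u)%:R))].
  by rewrite herm_ket.
set d := A i i in Ai; pose B := fun s t => A s t - d^-1 * (A s i * A i t).
have d0 : 0 <= d by apply: psd_diag_ge0.
have dr : d^* = d by apply: geC0_conj.
have AE : A = fun s t => d^-1 * outer (A^~ i) (A^~ i) s t + B s t.
  by apply: op_ext => s t; rewrite /outer psd_entry_conj // /B; ring.
rewrite AE lh addr_ge0 ?mulr_ge0 ?invr_ge0 //; apply: IH.
  rewrite -ltnS; apply: leq_trans ltn; rewrite ltnS; apply: proper_card; apply/properP; split.
    apply/subsetP => s; rewrite !inE; apply: contra => /eqP As.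
    have := As; rewrite -herm_ket => /(psd_null pA)[_ /(_ (fun u => (i == u)%:R))].
    by rewrite herm_ket /B As => ->; rewrite mul0r mulr0 subrr.
  exists i; rewrite !inE // /B -/d negbK mulrA mulVf // mul1r subrr //.
move=> w; rewrite -/(herm B w w).
have Bw : herm B w w = herm A w w - d^-1 * (appv A w i)^* * appv A w i.
  rewrite -!herm_ketl psd_conj // hermE (eq_bigr (fun s => (w s)^* * appv A w s
      - d^-1 * ((w s)^* * A s i) * appv A w i)).
    rewrite sumrB -hermE; congr (_ - _); rewrite herm_ketl -mulr_suml -mulr_sumr hermE.
    by rewrite appv_ket.
  by move=> s _; rewrite /appv /B !mulr_sumr -sumrB; apply: eq_bigr => t _; ring.
(* This [k] minimizes the form of [A] at [w + k e_i], and the minimum is the value of the Schur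
   complement [B] at [w]. *)
pose k := - (d^-1 * appv A w i).
have := pA (lincomb k (fun t => (i == t)%:R) w); rewrite -/(herm _ _ _) herm_lincomb herm_ket.
rewrite -(psd_conj w (fun t => (i == t)%:R) pA) herm_ketl -/d.
rewrite Bw /k rmorphN rmorphM /= fmorphV /= dr.
by congr (0 <= _); field.
Qed.

(** * Rank-one operators and projectors with a prescribed image *)

Lemma herm_id (R : realType) (X : {fset nat}) (v : vec R X) :
  herm (idop R X) v v = \sum_s (v s)^* * v s.
Proof. by rewrite hermE app1v. Qed.

Lemma psd_idop (R : realType) (X : {fset nat}) : psd (idop R X).
Proof.
move=> v; rewrite -/(herm _ v v) herm_id sumr_ge0 // => s _.
by rewrite mulrC mul_conjC_ge0.
Qed.

Lemma tr_outer (R : realType) (I : finType) (v w : I -> R[i]) :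
  tr (outer v w) = \sum_s (w s)^* * v s.
Proof. by apply: eq_bigr => s _; rewrite /outer mulrC. Qed.

Lemma tr_outer_ge0 (R : realType) (I : finType) (v : I -> R[i]) : 0 <= tr (outer v v).
Proof. by rewrite sumr_ge0 // => s _; apply: mul_conjC_ge0. Qed.

Lemma tr_outer_eq0 (R : realType) (I : finType) (v : I -> R[i]) :
  tr (outer v v) = 0 -> v = fun=> 0.
Proof.
move/eqP; rewrite psumr_eq0 => [/allP h|s _]; last exact: mul_conjC_ge0.
apply: vec_ext => s; have := h s (mem_index_enum _); rewrite /outer /= mul_conjC_eq0.
by move/eqP.
Qed.

Lemma mulo_outer (R : realType) (I : finType) (A : I -> I -> R[i]) v w :
  mulo A (outer v w) = outer (appv A v) w.
Proof.
by apply: op_ext => s t; rewrite /mulo /outer /appv mulr_suml; apply: eq_bigr => u _; rewrite mulrA.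
Qed.

Lemma proj_tr_le (R : realType) (X : {fset nat}) (P : op R X) :
  is_proj P -> tr P <= #|st X|%:R.
Proof.
move=> /proj_compl/tr_proj_psd/(_ (@psd_idop R X)); rewrite tr_compl subr_ge0 tr_mulo mul1o.
rewrite {2}/tr (eq_bigr (fun=> 1)) ?sumr_const // => s _.
by rewrite /idop eqxx.
Qed.

(** The kernel vector [w] is orthogonal to the image of [P], so the cross terms vanish when the
    normalized projector onto [w] is added and squared. *)
Lemma proj_extend (R : realType) (X : {fset nat}) (P : op R X) w :
  is_proj P -> appv P w = (fun=> 0) -> tr (outer w w) != 0 ->
  let Q := fun s t => P s t + (tr (outer w w))^-1 * outer w w s t in
  is_proj Q /\ tr Q = tr P + 1.
Proof.
set d := tr _ => -[PP aP] Pw dn Q.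
have d0 : 0 <= d := tr_outer_ge0 w; have dr : d^* = d by apply: geC0_conj.
split; last by rewrite /tr big_split -mulr_sumr /= -[X in _ * X]/d mulVf.
split; apply: op_ext => s t.
  transitivity (mulo P P s t + d^-1 * (w t)^* * appv P w s + d^-1 * w s * (appv P w t)^*
     + d^-1 * d^-1 * w s * (w t)^* * \sum_u (w u)^* * w u).
    rewrite /mulo /appv rmorph_sum !mulr_sumr -!big_split; apply: eq_bigr => u _ /=.
    by rewrite rmorphM /= -[(P t u)^*]/(adj P u t) aP /Q /outer; ring.
  by rewrite PP Pw rmorph0 -tr_outer -/d /Q /outer; field.
rewrite /adj /Q rmorphD /= -[(P t s)^*]/(adj P s t) aP; congr (_ + _).
by rewrite rmorphM fmorphV /= dr /outer rmorphM /= conjCK; ring.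
Qed.

(* A projector below [L] that misses a vector of [L] extends to one of trace larger by 1,
   and traces are bounded by the dimension. *)
Lemma proj_exists (R : realType) (X : {fset nat}) (L : vec R X -> Prop) :
  subspace L -> exists P, is_proj P /\ forall v, image P v <-> L v.
Proof.
move=> sL; apply: NNPP => noP.
have step n : exists P : op R X, [/\ is_proj P, forall v, image P v -> L v & tr P = n%:R].
  elim: n => [|n [P [pP PL trP]]].
    exists (zop R X); split; first exact: proj_zop.
      by move=> v /image_zop ->; case: sL.
    by rewrite /tr big1.
  have [v Lv nPv] : exists2 v, L v & ~ image P v.
    apply: NNPP => nv; apply: noP; exists P; split=> // v; split; first exact: PL.
    by move=> Lv; apply: NNPP => nP; apply: nv; exists v.
  (* The component [v - P v] is killed by [P], stays in [L], and is nonzero because [v] is outside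
     the image. *)
  pose w := lincomb (-1) (appv P v) v.
  have Lw : L w by apply: (proj2 sL) => //; apply/PL/image_appv.
  have Pw : appv P w = fun=> 0.
    rewrite appv_lincomb -appv_mulo (proj1 pP); apply: vec_ext => s.
    by rewrite /lincomb mulN1r addNr.
  have dn : tr (outer w w) != 0.
    apply/eqP => /tr_outer_eq0 w0; apply: nPv; exists v; apply: vec_ext => s.
    have := congr1 (fun f => f s) w0; rewrite /w /lincomb mulN1r => /eqP.
    by rewrite addrC subr_eq0 => /eqP.
  have [pQ trQ] := proj_extend pP Pw dn; exists (fun s t => P s t + (tr (outer w w))^-1 * outer w w s t).
  split=> //; last by rewrite trQ trP -natr1.
  apply: subspace_image => // t; set c := (tr _)^-1.
  rewrite (_ : (fun _ => _) = lincomb (c * (w t)^*) w (P^~ t)).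
    by apply: (proj2 sL) => //; apply/PL/image_col.
  by apply: vec_ext => s; rewrite /lincomb /outer; ring.
(* A projector whose trace exceeds the dimension by one is the contradiction. *)
have [P [/proj_tr_le le _ trP]] := step #|st X|.+1.
by move: le; rewrite trP ler_nat ltnn.
Qed.

(** * Basis states, extensions and slices *)

Lemma memb_sub (X : {fset nat}) (s : st X) q : memb s q -> q \in X.
Proof. by case/existsP => x /andP[_ /eqP <-]; apply: fsvalP. Qed.

Lemma memb_val (X : {fset nat}) (s : st X) (x : fset_sub_type X) : memb s (val x) = (x \in s).
Proof.
apply/existsP/idP => [[y /andP[ys /eqP/val_inj <-]]|xs] //.
by exists x; rewrite xs eqxx.
Qed.

Lemma st_ext (X : {fset nat}) (s t : st X) :
  (forall q, q \in X -> memb s q = memb t q) -> s = t.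
Proof. by move=> h; apply/setP => x; rewrite -!memb_val h // fsvalP. Qed.

(** Membership is tested at natural numbers rather than at elements of a subtype, so that states of
    different systems can be compared qubit by qubit. *)
Lemma memb_set (X : {fset nat}) (p : pred nat) q :
  memb [set x : fset_sub_type X | p (val x)] q = (q \in X) && p q.
Proof.
have [qX|qX] := boolP (q \in X); last by apply: contraNF qX; apply: memb_sub.
by rewrite -[q]/(val [` qX]) memb_val inE.
Qed.

Lemma memb_restr (X Y : {fset nat}) (s : st X) q :
  memb (restr Y s) q = (q \in Y) && memb s q.
Proof. exact: (memb_set Y (memb s)). Qed.

Lemma memb_join (V X : {fset nat}) (u : st V) (s : st X) q :
  memb (join u s) q = (q \in X) && (if q \in V then memb u q else memb s q).
Proof. exact: (memb_set X (fun q => if q \in V then memb u q else memb s q)). Qed.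

Lemma agree_offP (U X : {fset nat}) (s t : st X) :
  reflect (forall q, q \in X -> q \notin U -> memb s q = memb t q) (agree_off U s t).
Proof.
apply: (iffP forallP) => [h q qX qU|h x].
  by move/implyP: (h [` qX]) => /(_ qU)/eqP.
by apply/implyP => xU; apply/eqP/h => //; apply: fsvalP.
Qed.

Lemma restr_id (X : {fset nat}) (s : st X) : restr X s = s.
Proof. by apply: st_ext => q qX; rewrite memb_restr qX. Qed.

Lemma restr_restr (U Y X : {fset nat}) (s : st X) :
  U `<=` Y -> restr U (restr Y s) = restr U s.
Proof.
move=> UY; apply: st_ext => q qU; rewrite !memb_restr qU /=.
by rewrite (fsubsetP UY).
Qed.

Lemma restr_join (U X : {fset nat}) (u : st U) (s : st X) :
  U `<=` X -> restr U (join u s) = u.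
Proof.
by move=> UX; apply: st_ext => q qU; rewrite memb_restr memb_join qU (fsubsetP UX).
Qed.

Lemma join_restr (U X : {fset nat}) (s t : st X) :
  agree_off U s t -> join (restr U t) s = t.
Proof.
move=> /agree_offP h; apply: st_ext => q qX; rewrite memb_join memb_restr qX /=.
by case: (boolP (q \in U)) => [|qU] //=; apply: h.
Qed.

Lemma agree_off_join (U X : {fset nat}) (u : st U) (s : st X) : agree_off U s (join u s).
Proof. by apply/agree_offP => q qX /negbTE qU; rewrite memb_join qX qU. Qed.

Lemma agree_off_refl (U X : {fset nat}) (s : st X) : agree_off U s s.
Proof. exact/agree_offP. Qed.

Lemma join_restr_id (U X : {fset nat}) (s : st X) : join (restr U s) s = s.
Proof. exact/join_restr/agree_off_refl. Qed.

Lemma join_full (X : {fset nat}) (u s : st X) : join u s = u.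
Proof. by apply: st_ext => q qX; rewrite memb_join qX. Qed.

Lemma join_join (U X : {fset nat}) (u w : st U) (s : st X) : join u (join w s) = join u s.
Proof. by apply: st_ext => q qX; rewrite !memb_join qX /=; case: (q \in U). Qed.

Lemma join_assoc (V U X : {fset nat}) (a : st V) (u : st U) (s : st X) :
  V `<=` U -> join a (join u s) = join (join a u) s.
Proof.
move=> VU; apply: st_ext => q qX; rewrite !memb_join qX /=.
by case: (boolP (q \in V)) => [/(fsubsetP VU) ->|_] //; case: (q \in U).
Qed.

Lemma restr_join_sub (V U X : {fset nat}) (u : st U) (s : st X) :
  V `<=` U -> U `<=` X -> restr V (join u s) = restr V u.
Proof. by move=> VU UX; rewrite -(restr_restr (join u s) VU) restr_join. Qed.

Lemma restr_joinC (V Y X : {fset nat}) (u : st V) (s : st X) :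
  Y `<=` X -> restr Y (join u s) = join u (restr Y s).
Proof.
move=> YX; apply: st_ext => q qY; rewrite memb_restr !memb_join qY (fsubsetP YX) //=.
by rewrite memb_restr qY.
Qed.

Lemma join_disjoint (V X : {fset nat}) (u : st V) (s : st X) :
  fdisjoint X V -> join u s = s.
Proof.
move=> /fdisjointP XV; apply: st_ext => q qX; rewrite memb_join qX /=.
by rewrite (negbTE (XV q qX)).
Qed.

(** The states that agree with [s] off [U] are exactly the [join u s], so the identity factor in
    [ext] cuts a sum over [X] down to a sum over [U]. *)
Lemma sum_agree_off (R : realType) (U X : {fset nat}) (s : st X) (f : st X -> R[i]) :
  U `<=` X -> \sum_t f t * (agree_off U s t)%:R = \sum_u f (@join U X u s).
Proof.
move=> UX; rewrite (bigID (agree_off U s)) /= [X in _ + X]big1 ?addr0; last first.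
  by move=> t /negbTE ->; rewrite mulr0.
rewrite (reindex_onto (fun u : st U => join u s) (restr U)) /=; last exact: join_restr.
apply: eq_big => [u|u /andP[-> _]]; last by rewrite mulr1.
by rewrite agree_off_join restr_join // eqxx.
Qed.

(* The pairs [(u, s)] and [(restr U s, join u s)] are exchanged by an involution. *)
Lemma sum_join (R : realType) (U X : {fset nat}) (f : st U -> st X -> R[i]) :
  U `<=` X -> (forall (u w : st U) s, f u (join w s) = f u s) ->
  \sum_s \sum_u f u s = #|st U|%:R * \sum_s f (restr U s) s.
Proof.
move=> UX fj; pose g (p : st X * st U) := (@join U X p.2 p.1, restr U p.1).
have gK : involutive g.
  by move=> [s u]; rewrite /g /= restr_join // join_join join_restr_id.
rewrite pair_big /= (reindex_inj (inv_inj gK)) /=.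
rewrite -(pair_big xpredT xpredT (fun s u => f (restr U s) (join u s))) /= mulr_sumr.
apply: eq_bigr => s _; rewrite (eq_bigr (fun=> f (restr U s) s)) ?sumr_const ?mulr_natl //.
Qed.

(** The component of [v] at the basis state of the environment given by [s] off [U]. Indexing by a
    state of all of [X] avoids a separate system for the environment, at the cost of counting each
    slice [#|st U|] times in sums. *)
Definition slice (R : realType) (U X : {fset nat}) (v : vec R X) (s : st X) : vec R U :=
  fun u => v (join u s).
Arguments slice {R} U {X} v s _.

Definition block (R : realType) (U X : {fset nat}) (A : op R X) (s t : st X) : op R U :=
  fun u w => A (join u s) (join w t).
Arguments block {R} U {X} A s t _ _.

Lemma appv_ext (R : realType) (U X : {fset nat}) (A : op R U) (v : vec R X) s :
  U `<=` X -> appv (ext X A) v s = appv A (slice U v s) (restr U s).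
Proof.
move=> UX; rewrite /appv /ext.
under eq_bigr do rewrite mulrAC.
rewrite (sum_agree_off _ (fun t => A (restr U s) (restr U t) * v t)) //.
by apply: eq_bigr => u _; rewrite restr_join.
Qed.

Lemma slice_appv_ext (R : realType) (U X : {fset nat}) (A : op R U) (v : vec R X) s :
  U `<=` X -> slice U (appv (ext X A) v) s = appv A (slice U v s).
Proof.
move=> UX; apply: vec_ext => u; rewrite {1}/slice appv_ext // restr_join //.
by congr appv; apply: vec_ext => w; rewrite /slice join_join.
Qed.

Lemma mulo_ext (R : realType) (U X : {fset nat}) (A : op R U) (B : op R X) s t :
  U `<=` X -> mulo (ext X A) B s t = \sum_u A (restr U s) u * B (join u s) t.
Proof. exact: appv_ext. Qed.

Lemma ext_mulo (R : realType) (U X : {fset nat}) (A B : op R U) :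
  U `<=` X -> mulo (ext X A) (ext X B) = ext X (mulo A B).
Proof.
move=> UX; apply: op_ext => s t; rewrite mulo_ext // /ext /mulo mulr_suml.
apply: eq_bigr => u _; rewrite restr_join // mulrA; congr (_ * (nat_of_bool _)%:R).
by apply/agree_offP/agree_offP => h q qX qU; have := h q qX qU;
  rewrite memb_join qX (negbTE qU).
Qed.

Lemma adj_ext (R : realType) (U X : {fset nat}) (A : op R U) : adj (ext X A) = ext X (adj A).
Proof.
apply: op_ext => s t; rewrite /adj /ext rmorphM rmorph_nat; congr (_ * (nat_of_bool _)%:R).
by apply/agree_offP/agree_offP => h q qX qU; rewrite h.
Qed.

Lemma proj_ext (R : realType) (U X : {fset nat}) (P : op R U) :
  U `<=` X -> is_proj P -> is_proj (ext X P).
Proof. by move=> UX [PP aP]; split; [rewrite ext_mulo // PP | rewrite adj_ext aP]. Qed.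

Lemma ext_id (R : realType) (X : {fset nat}) (A : op R X) : ext X A = A.
Proof.
apply: op_ext => s t; rewrite /ext !restr_id (_ : agree_off X s t) ?mulr1 //.
by apply/agree_offP => q ->.
Qed.

Lemma ext_ext (R : realType) (U Y X : {fset nat}) (A : op R U) :
  U `<=` Y -> Y `<=` X -> ext X (ext Y A) = ext X A.
Proof.
move=> UY YX; apply: op_ext => s t; rewrite /ext !restr_restr // -mulrA -natrM mulnb.
congr (_ * (nat_of_bool _)%:R).
apply/andP/agree_offP => [[/agree_offP h1 /agree_offP h2] q qX qU|h].
  have [qY|qY] := boolP (q \in Y); last exact: h2.
  by have := h1 q qY qU; rewrite !memb_restr qY.
split; apply/agree_offP => q qX qU.
  by rewrite !memb_restr qX /=; apply: h => //; apply: (fsubsetP YX).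
by apply: h => //; apply: contra qU; apply: (fsubsetP UY).
Qed.

Lemma ext_idop (R : realType) (U X : {fset nat}) : U `<=` X -> ext X (idop R U) = idop R X.
Proof.
move=> UX; apply: op_ext => s t; rewrite /ext /idop -natrM mulnb; congr ((nat_of_bool _)%:R).
apply/andP/eqP => [[/eqP rst /agree_offP h]|->]; last by rewrite eqxx agree_off_refl.
apply: st_ext => q qX; have [qU|qU] := boolP (q \in U); last exact: h.
by have := congr1 (fun s => memb s q) rst; rewrite !memb_restr qU.
Qed.

(** [ext X P] applies [P] to each slice separately, so being fixed by it is a condition on
    slices. *)
Lemma image_ext (R : realType) (U X : {fset nat}) (P : op R U) (v : vec R X) :
  U `<=` X -> is_proj P -> image (ext X P) v <-> forall s, image P (slice U v s).
Proof.
move=> UX pP; rewrite proj_imageP; last exact: proj_ext.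
split=> [Pv s|h]; first by rewrite -Pv slice_appv_ext //; apply: image_appv.
apply: vec_ext => s; rewrite appv_ext //; have /proj_imageP -/(_ pP) -> := h s.
by rewrite /slice join_restr_id.
Qed.

Lemma psub_ext (R : realType) (U X : {fset nat}) (P Q : op R U) :
  U `<=` X -> is_proj P -> is_proj Q -> psub P Q -> psub (ext X P) (ext X Q).
Proof. by move=> UX pP pQ PQ v; rewrite !image_ext // => h s; apply/PQ/h. Qed.

(** A partial trace over the environment: the factor [#|st U|] arises since [s] runs over all states
    of [X] and the block depends only on [s] off [U]. *)
Lemma tr_ext (R : realType) (U X : {fset nat}) (B : op R U) (A : op R X) :
  U `<=` X -> \sum_s tr (mulo B (block U A s s)) = #|st U|%:R * tr (mulo (ext X B) A).
Proof.
move=> UX; rewrite {1}/tr sum_join // => [|u w s]; last first.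
  by apply: eq_bigr => a _; rewrite /block !join_join.
congr (_ * _); apply: eq_bigr => s _; rewrite mulo_ext //; apply: eq_bigr => u _.
by rewrite /block join_restr_id.
Qed.

Lemma tr_block (R : realType) (U X : {fset nat}) (A : op R X) :
  U `<=` X -> \sum_s tr (block U A s s) = #|st U|%:R * tr A.
Proof.
move=> UX; rewrite -[in RHS](mul1o A) -(ext_idop R UX) -tr_ext //.
by apply: eq_bigr => s _; rewrite mul1o.
Qed.

Lemma card_st_gt0 (R : realType) (X : {fset nat}) : 0 < #|st X|%:R :> R[i].
Proof. by rewrite ltr0n; apply/card_gt0P; exists set0. Qed.

(** * Positivity under reindexing, and null vectors of linear forms on operators *)

Lemma sum_fiber (R : realType) (I J : finType) (f : J -> I) (g : I -> R[i]) (v : J -> R[i]) :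
  \sum_j g (f j) * v j = \sum_i g i * \sum_(j | f j == i) v j.
Proof.
rewrite (partition_big f xpredT) //=; apply: eq_bigr => i _.
by rewrite mulr_sumr; apply: eq_bigr => j /eqP ->.
Qed.

(** The form of the reindexed matrix at [v] is the form of [A] at the push-forward of [v], which
    sums [v] over the fibres of [f]. Blocks and ancilla systems are both obtained by such
    reindexing. *)
Lemma psd_comp (R : realType) (I J : finType) (f : J -> I) (A : I -> I -> R[i]) :
  psd A -> psd (fun x y => A (f x) (f y)).
Proof.
move=> pA v; pose w i := \sum_(j | f j == i) v j.
have := pA w; rewrite -/(herm _ _ _) -/(herm _ v v) !hermE.
rewrite [X in _ -> 0 <= X](eq_bigr (fun j => appv A w (f j) * (v j)^*)) => [|j _]; last first.
  by rewrite mulrC; congr (_ * _); apply: (sum_fiber f (A (f j))).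
rewrite sum_fiber; congr (0 <= _); apply: eq_bigr => i _.
by rewrite mulrC /w rmorph_sum.
Qed.

Lemma psd_outer (R : realType) (I : finType) (v : I -> R[i]) : psd (outer v v).
Proof.
move=> w; pose z := \sum_s (w s)^* * v s.
rewrite (_ : (\sum_s _) = z * z^*) ?mul_conjC_ge0 // /z mulr_suml; apply: eq_bigr => s _.
rewrite rmorph_sum mulr_sumr; apply: eq_bigr => t _.
by rewrite rmorphM /= conjCK /outer; ring.
Qed.

Lemma outer_lincombl (R : realType) (I : finType) c (v w z : I -> R[i]) :
  outer (lincomb c v w) z = fun s t => c * outer v z s t + outer w z s t.
Proof. by apply: op_ext => s t; rewrite /outer /lincomb; ring. Qed.

Lemma outer_lincombr (R : realType) (I : finType) c (v w z : I -> R[i]) :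
  outer z (lincomb c v w) = fun s t => c^* * outer z v s t + outer z w s t.
Proof. by apply: op_ext => s t; rewrite /outer /lincomb rmorphD rmorphM /=; ring. Qed.

Lemma linear_form_outer (R : realType) (I : finType) (h : (I -> I -> R[i]) -> R[i]) c v w :
  linear_form h ->
  h (outer (lincomb c v w) (lincomb c v w)) =
  h (outer w w) + c * h (outer v w) + c^* * h (outer w v) + c^* * c * h (outer v v).
Proof. by move=> lh; rewrite outer_lincombl lh !outer_lincombr !lh; ring. Qed.

(** The argument of [psd_null], applied to the positive sesquilinear form [h (outer v w)]. *)
Lemma linear_form_null (R : realType) (I : finType) (h : (I -> I -> R[i]) -> R[i]) v :
  linear_form h -> (forall v, 0 <= h (outer v v)) -> h (outer v v) = 0 ->
  (forall w, h (outer v w) = 0) /\ (forall w, h (outer w v) = 0).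
Proof.
move=> lh h0 v0.
suff H w : h (outer v w) = 0 /\ h (outer w v) = 0 by split=> w; case: (H w).
apply: (@null_of_affine_ge0 _ (h (outer w w))) => t.
by have := h0 (lincomb t v w); rewrite linear_form_outer // v0 mulr0 addr0.
Qed.

Lemma linear_form_null_subspace (R : realType) (I : finType) (h : (I -> I -> R[i]) -> R[i]) :
  linear_form h -> (forall v, 0 <= h (outer v v)) -> subspace (fun v => h (outer v v) = 0).
Proof.
move=> lh h0; split.
  rewrite (_ : outer _ _ = fun _ _ => 0) ?linear_form0 //.
  by apply: op_ext => s t; rewrite /outer mul0r.
move=> c v w hv hw; have [vn wn] := linear_form_null lh h0 hv.
by rewrite linear_form_outer // hv hw vn wn !mulr0 !addr0.
Qed.

Lemma tr_linear (R : realType) (I : finType) : linear_form (@tr R I).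
Proof. by move=> c A B; rewrite /tr mulr_sumr -big_split. Qed.

Lemma tr_mulo_linear (R : realType) (I : finType) (P : I -> I -> R[i]) :
  linear_form (fun A => tr (mulo P A)).
Proof.
move=> c A B; rewrite -tr_linear; congr tr; apply: op_ext => s t.
by rewrite /mulo mulr_sumr -big_split; apply: eq_bigr => u _ /=; ring.
Qed.

Lemma linear_formB (R : realType) (I : finType) (h k : (I -> I -> R[i]) -> R[i]) :
  linear_form h -> linear_form k -> linear_form (fun A => h A - k A).
Proof. by move=> lh lk c A B; rewrite lh lk; ring. Qed.

Lemma psd_scale (R : realType) (I : finType) (c : R[i]) (A : I -> I -> R[i]) :
  0 <= c -> psd A -> psd (fun s t => c * A s t).
Proof.
move=> c0 pA v; rewrite (_ : (\sum_s _) = c * herm A v v); first by rewrite mulr_ge0 //; apply: pA.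
rewrite mulr_sumr; apply: eq_bigr => s _; rewrite mulr_sumr; apply: eq_bigr => t _; ring.
Qed.

Lemma linear_form_scale (R : realType) (I : finType) (h : (I -> I -> R[i]) -> R[i]) c A :
  linear_form h -> h (fun s t => c * A s t) = c * h A.
Proof.
move=> lh; rewrite -[RHS]addr0 -(linear_form0 lh) -lh; congr h.
by apply: op_ext => s t; rewrite addr0.
Qed.

Lemma tr_outer_proj (R : realType) (X : {fset nat}) (P : op R X) v :
  is_proj P -> tr (outer (appv P v) v) = tr (outer (appv P v) (appv P v)).
Proof.
case=> PP aP; rewrite -mulo_outer -{1}PP -muloA tr_mulo -muloA.
have -> : mulo (outer v v) P = outer v (appv P v).
  apply: op_ext => s t; rewrite /mulo /outer /appv rmorph_sum mulr_sumr.
  apply: eq_bigr => u _.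
  by rewrite rmorphM /= -[(P t u)^*]/(adj P u t) aP; ring.
by rewrite mulo_outer.
Qed.

(** This reduces both correctness notions to vanishing on pure states: the right-hand side is zero
    on states in the image of [P], and conversely only the component of [v] orthogonal to that image
    contributes to [h]. *)
Lemma form_le_projP (R : realType) (X : {fset nat}) (h : op R X -> R[i]) (P : op R X) :
  linear_form h -> (forall v, 0 <= h (outer v v) <= tr (outer v v)) -> is_proj P ->
  (forall rho, pdens rho -> h rho <= tr rho - tr (mulo P rho)) <->
  (forall v, image P v -> h (outer v v) = 0).
Proof.
move=> lh hb pP; have h0 v : 0 <= h (outer v v) by case/andP: (hb v).
split=> [H v /(proj_imageP _ pP) Pv|H rho [prho _]].
  apply/eqP; rewrite eq_le h0 andbT.
  (* Dividing by the trace plus one yields a partial density operator even when [v] is zero. *)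
  have c0 : 0 < tr (outer v v) + 1 by rewrite ltr_wpDl ?tr_outer_ge0.
  set c := _ + 1 in c0; have ci : 0 <= c^-1 by rewrite invr_ge0 ltW.
  have /H : pdens (fun s t => c^-1 * outer v v s t).
    split; first exact/psd_scale/psd_outer.
    rewrite (linear_form_scale _ _ (@tr_linear _ _)) mulrC ler_pdivrMr // mul1r.
    by rewrite lerDl ler01.
  rewrite (linear_form_scale _ _ lh) (linear_form_scale _ _ (@tr_linear _ _)).
  rewrite (linear_form_scale _ _ (tr_mulo_linear P)) mulo_outer Pv subrr.
  by rewrite pmulr_rle0 // invr_gt0.
rewrite -subr_ge0.
have lk := linear_formB (linear_formB (@tr_linear R _) (tr_mulo_linear P)) lh.
apply: (linear_form_psd_ge0 lk) prho => v; rewrite subr_ge0.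
(* Since [P v] is null, [h] takes the same value at [v] and at [b = v - P v]; there it is at most
   [<b|b>], which is [<v|(I - P) v>]. *)
pose b := appv (compl P) v; have vE : v = lincomb 1 (appv P v) b.
  by apply: vec_ext => s; rewrite /lincomb /b appv_compl mul1r addrC subrK.
have hP := H _ (image_appv P v); have [h1 h2] := linear_form_null lh h0 hP.
rewrite -tr_compl mulo_outer {1 2}vE linear_form_outer // hP h1 h2 !mulr0 !addr0.
case/andP: (hb b) => _ /le_trans; apply.
by rewrite -/b /b tr_outer_proj //; apply: proj_compl.
Qed.

(** * Super-operators and correctness *)

(** Complete positivity is used with all of [st X] as ancilla index: [A] is pulled back to pairs
    along [join], and the result is restricted to the pairs [(restr V s, s)]. *)
Lemma psd_sapp (R : realType) (V X : {fset nat}) (E : sop R V) (A : op R X) :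
  completely_positive E -> psd A -> psd (sapp E A).
Proof.
move=> cp pA.
have := cp _ _ (psd_comp (fun p : st V * st X => join p.1 p.2) pA).
exact: (psd_comp (fun s : st X => (restr V s, s))).
Qed.

Lemma sapp_linear (R : realType) (V X : {fset nat}) (E : sop R V) c (A B : op R X) :
  sop_linear E ->
  sapp E (fun s t => c * A s t + B s t) = fun s t => c * sapp E A s t + sapp E B s t.
Proof. by move=> lE; apply: op_ext => s t; rewrite /sapp lE. Qed.

Lemma block_sapp (R : realType) (V U X : {fset nat}) (E : sop R V) (A : op R X) s t :
  V `<=` U -> U `<=` X -> block U (sapp E A) s t = sapp E (block U A s t).
Proof.
move=> VU UX; apply: op_ext => u w; rewrite /block /sapp !restr_join_sub //.
by congr E; apply: op_ext => a b; rewrite !join_assoc.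
Qed.

Lemma sapp_self (R : realType) (V : {fset nat}) (E : sop R V) (A : op R V) : sapp E A = E A.
Proof.
apply: op_ext => s t; rewrite /sapp !restr_id; congr E.
by apply: op_ext => u w; rewrite !join_full.
Qed.

(** The trace is a sum over diagonal [V]-blocks; each block is positive and [E] acts on it
    directly. *)
Lemma tr_sapp_le (R : realType) (V X : {fset nat}) (E : sop R V) (A : op R X) :
  V `<=` X -> trace_nonincreasing E -> psd A -> tr (sapp E A) <= tr A.
Proof.
move=> VX tE pA; rewrite -(ler_pM2l (card_st_gt0 R V)) -!tr_block //.
apply: ler_sum => s _; rewrite block_sapp // sapp_self; apply: tE.
exact: (psd_comp (fun u : st V => join u s)).
Qed.

(* [gap b E B A] measures by how much total ([b]) or partial ([~~ b]) correctness with
   postcondition [B] fails on the input [A]. *)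
Definition gap (R : realType) (b : bool) (V X : {fset nat}) (E : sop R V) (B A : op R X) : R[i] :=
  (if b then tr A else tr (sapp E A)) - tr (mulo B (sapp E A)).

Lemma gap_linear (R : realType) b (V X : {fset nat}) (E : sop R V) (B : op R X) :
  sop_linear E -> linear_form (gap b E B).
Proof.
move=> lE c A D; rewrite /gap sapp_linear // tr_mulo_linear.
by case: b; rewrite tr_linear; ring.
Qed.

(** Splits the failure into lost trace, counted for total correctness only, and the weight of the
    output outside [B]. *)
Lemma gapE (R : realType) b (V X : {fset nat}) (E : sop R V) (B A : op R X) :
  gap b E B A = (if b then tr A - tr (sapp E A) else 0) + tr (mulo (compl B) (sapp E A)).
Proof. by rewrite tr_compl /gap; case: b; ring. Qed.

Lemma gap_ge0 (R : realType) b (V X : {fset nat}) (E : sop R V) (B A : op R X) :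
  V `<=` X -> DProg E -> is_proj B -> psd A -> 0 <= gap b E B A.
Proof.
move=> VX [lE cp tE] pB pA; rewrite gapE addr_ge0 //.
  by case: b; rewrite // subr_ge0 tr_sapp_le.
by apply: tr_proj_psd; [apply: proj_compl | apply: psd_sapp].
Qed.

Lemma gap_le (R : realType) b (V X : {fset nat}) (E : sop R V) (B A : op R X) :
  V `<=` X -> DProg E -> is_proj B -> psd A -> gap b E B A <= tr A.
Proof.
move=> VX [lE cp tE] pB pA; rewrite /gap lerBlDr; apply: ler_wpDr.
  exact/tr_proj_psd/psd_sapp.
by case: b => //; apply: tr_sapp_le.
Qed.

Lemma gap_slices (R : realType) b (V U X : {fset nat}) (E : sop R V) (B : op R U) (A : op R X) :
  V `<=` U -> U `<=` X ->
  \sum_s gap b E B (block U A s s) = #|st U|%:R * gap b E (ext X B) A.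
Proof.
move=> VU UX; rewrite /gap mulrBr sumrB -tr_ext //; congr (_ - _).
  case: b; rewrite -tr_block //.
  by apply: eq_bigr => s _; rewrite block_sapp.
by apply: eq_bigr => s _; rewrite block_sapp.
Qed.

Definition null (R : realType) (b : bool) (V X : {fset nat}) (E : sop R V) (B : op R X)
  (v : vec R X) : Prop := gap b E B (outer v v) = 0.

Lemma null_subspace (R : realType) b (V X : {fset nat}) (E : sop R V) (B : op R X) :
  V `<=` X -> DProg E -> is_proj B -> subspace (null b E B).
Proof.
move=> VX dE pB; apply: linear_form_null_subspace.
  by apply: gap_linear; case: dE.
by move=> v; apply: gap_ge0 => //; apply: psd_outer.
Qed.

(** By [gap_slices] the nonnegative gaps of the slices add up to a positive multiple of the gap on
    [X]. *)
Lemma null_ext (R : realType) b (V U X : {fset nat}) (E : sop R V) (B : op R U) (v : vec R X) :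
  V `<=` U -> U `<=` X -> DProg E -> is_proj B ->
  null b E (ext X B) v <-> forall s, null b E B (slice U v s).
Proof.
move=> VU UX dE pB; have := gap_slices b E B (outer v v) VU UX; rewrite /null => gs.
split=> [h s|h].
  move: gs; rewrite h mulr0 => /eqP; rewrite psumr_eq0 => [|t _].
    by move=> /allP/(_ s (mem_index_enum _))/eqP.
  by apply: gap_ge0 => //; apply: psd_outer.
move: gs; rewrite big1 => [|s _]; last exact: h.
by move/esym/eqP; rewrite mulf_eq0 gt_eqF ?card_st_gt0 //= => /eqP.
Qed.

(** A zero trace of [I - B] against the positive output forces [(I - B) E(|v><v|) = 0]. *)
Lemma null_parP (R : realType) (V X : {fset nat}) (E : sop R V) (B : op R X) (v : vec R X) :
  DProg E -> is_proj B ->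
  null false E B v <-> forall u, image B (appv (sapp E (outer v v)) u).
Proof.
move=> [_ cp _] pB; have pA := psd_sapp cp (psd_outer v).
rewrite /null gapE add0r; split=> [h u|h].
  apply/proj_imageP => //; apply: vec_ext => s.
  have := congr1 (fun f => f s) (tr_proj_psd_eq0 (proj_compl pB) pA h u).
  by rewrite appv_compl => /eqP; rewrite subr_eq0 => /eqP.
rewrite tr_compl (_ : mulo B _ = sapp E (outer v v)) ?subrr //.
apply: op_ext => s t; have /(proj_imageP _ pB) := h (fun u => (t == u)%:R).
by rewrite appv_ket => /(congr1 (fun f => f s)).
Qed.

Lemma null_totP (R : realType) (V X : {fset nat}) (E : sop R V) (B : op R X) (v : vec R X) :
  V `<=` X -> DProg E -> is_proj B ->
  null true E B v <-> null false E B v /\ tr (sapp E (outer v v)) = tr (outer v v).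
Proof.
move=> VX dE pB; have := gap_ge0 false VX dE pB (psd_outer v).
rewrite /null !gapE add0r => g0; case: dE => _ _ tE.
split=> [/eqP|[-> ->]]; last by rewrite subrr addr0.
rewrite paddr_eq0 // ?subr_ge0 ?tr_sapp_le //; last exact: psd_outer.
by case/andP => /eqP/subr0_eq -> /eqP ->.
Qed.

Lemma null_idop (R : realType) (V X : {fset nat}) (E : sop R V) (v : vec R X) :
  DProg E -> null false E (idop R X) v.
Proof. by move=> dE; apply/null_parP => //; [apply: proj_idop | move=> u; apply: image_idop]. Qed.

Definition sat (R : realType) (b : bool) (V U1 U2 : {fset nat}) (S : sop R V -> Prop)
    (P : op R U1) (Q : op R U2) : Prop :=
  if b then sat_tot S P Q else sat_par S P Q.

Lemma sat_gap (R : realType) b (V U1 U2 : {fset nat}) (S : sop R V -> Prop)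
    (P : op R U1) (Q : op R U2) :
  sat b S P Q <-> forall X, V `|` U1 `|` U2 `<=` X -> forall E, S E ->
    forall rho : op R X, pdens rho ->
    gap b E (ext X Q) rho <= tr rho - tr (mulo (ext X P) rho).
Proof.
have E1 (p q r : R[i]) : (p <= q) = (r - q <= r - p) by rewrite lerD2l lerN2.
have E2 (p q r e : R[i]) : (p <= q + r - e) = (e - q <= r - p).
  by rewrite -subr_ge0 -[RHS]subr_ge0; congr (0 <= _); ring.
rewrite /sat /gap; case: b; split=> H X UX.
- by move=> E SE rho pr; rewrite -E1; apply: H.
- by move=> rho pr E SE; rewrite (E1 _ _ (tr rho)); apply: H.
- by move=> E SE rho pr; rewrite -E2; apply: H.
- by move=> rho pr E SE; rewrite E2; apply: H.
Qed.

(** Images and null spaces are both determined slice by slice, so all larger systems [X] reduce to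
    the single system [U]. The equation for [U] accommodates unions such as [V], [V] and [W] joined
    in any shape. *)
Lemma sat_nullP (R : realType) b (V U1 U2 U : {fset nat}) (S : sop R V -> Prop)
    (P : op R U1) (Q : op R U2) :
  (forall E, S E -> DProg E) -> is_proj P -> is_proj Q -> U = V `|` U1 `|` U2 ->
  sat b S P Q <-> forall E, S E -> forall v, image (ext U P) v -> null b E (ext U Q) v.
Proof.
move=> dS pP pQ defU; have [[VU U1U] U2U] : (V `<=` U /\ U1 `<=` U) /\ U2 `<=` U.
  rewrite defU; split; last exact: fsubsetUr.
  by split; rewrite -fsetUA ?fsubsetUl // fsetUCA fsubsetUl.
rewrite sat_gap -defU.
have key X (UX : U `<=` X) E : S E ->
    (forall rho : op R X, pdens rho -> gap b E (ext X Q) rho <= tr rho - tr (mulo (ext X P) rho))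
    <-> forall v, image (ext X P) v -> null b E (ext X Q) v.
  move=> /dS dE; have VX := fsubset_trans VU UX.
  have pQX : is_proj (ext X Q) by apply: proj_ext => //; apply: fsubset_trans UX.
  apply: form_le_projP.
  - by apply: gap_linear; case: dE.
  - by move=> v; rewrite gap_ge0 ?gap_le //; apply: psd_outer.
  - by apply: proj_ext => //; apply: fsubset_trans UX.
split=> [H E SE|H X UX E SE]; first by apply/key/H.
apply/key => // v; rewrite -(ext_ext P U1U UX) -(ext_ext Q U2U UX).
rewrite image_ext //; last exact: proj_ext.
move=> h; apply/null_ext => //; [exact: dS | exact: proj_ext | move=> s].
exact/H.
Qed.

(** * Predicate transformers *)

Ltac fset_solve := let q := fresh "q" in
  solve [apply/fsetP => q; rewrite !inE; by do ![case: (q \in _)]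
    | apply/fsubsetP => q; rewrite !inE; by do ![case: (q \in _)]].

(** The Boolean lets the laws common to [wp] and [wlp] be proved once. *)
Definition xp (R : realType) (b : bool) (V W : {fset nat}) (S : sop R V -> Prop) (Q : op R W)
  : op R (V `|` W) := if b then wp S Q else wlp S Q.

(** The common null vectors form a subspace, whose projector [P0] is a largest solution. Hence
    [epsilon] also returns a largest solution, and maximality identifies the two images. *)
Lemma xpP (R : realType) b (V W : {fset nat}) (S : sop R V -> Prop) (Q : op R W) :
  (forall E, S E -> DProg E) -> is_proj Q ->
  is_proj (xp b S Q) /\
  forall v, image (xp b S Q) v <-> forall E, S E -> null b E (ext (V `|` W) Q) v.
Proof.
move=> dS pQ; have pQe : is_proj (ext (V `|` W) Q) by apply: proj_ext => //; fset_solve.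
have sub : subspace (fun v => forall E, S E -> null b E (ext (V `|` W) Q) v).
  have nS E : S E -> subspace (null b E (ext (V `|` W) Q)).
    by move=> /dS dE; apply: null_subspace => //; fset_solve.
  split=> [E /nS[]//|c v w hv hw E SE].
  by apply: (proj2 (nS E SE)); [apply: hv | apply: hw].
have satE P : is_proj P -> sat b S P Q <->
    forall E, S E -> forall v, image P v -> null b E (ext (V `|` W) Q) v.
  by move=> pP; rewrite (@sat_nullP _ _ _ _ _ (V `|` W)) // ?ext_id //; fset_solve.
have [P0 [pP0 P0E]] := proj_exists sub.
pose largest (P : op R (V `|` W)) := [/\ is_proj P, sat b S P Q &
  forall P', is_proj P' -> sat b S P' Q -> psub P' P].
have max0 : largest P0.
  split=> //; first by apply/satE => // E SE v /P0E; apply.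
  by move=> P' pP' /satE -/(_ pP') h v Pv; apply/P0E => E SE; apply: h.
have [pX sX mX] : largest (xp b S Q).
  have := epsilon_spec (op_inhabited R (V `|` W)) largest (ex_intro _ P0 max0).
  by rewrite /largest /xp /wp /wlp; clear; case: b.
split=> // v; split=> [xv E SE|h].
  by move/satE: sX => /(_ pX) h; apply: h.
by apply: mX pP0 _ _ _; [case: max0 | apply/P0E].
Qed.

Lemma xp_ext (R : realType) b (V W X : {fset nat}) (S : sop R V -> Prop) (Q : op R W) (v : vec R X) :
  (forall E, S E -> DProg E) -> is_proj Q -> V `|` W `<=` X ->
  image (ext X (xp b S Q)) v <-> forall E, S E -> null b E (ext X Q) v.
Proof.
move=> dS pQ VWX; have [pX xE] := xpP b dS pQ.
have VV : V `<=` V `|` W by fset_solve.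
have WV : W `<=` V `|` W by fset_solve.
have pQe : is_proj (ext (V `|` W) Q) by apply: proj_ext.
rewrite image_ext //; split=> [h E SE|h s].
  by rewrite -(ext_ext Q WV VWX); apply/(null_ext _ _ VV VWX (dS _ SE) pQe) => s; apply: (proj1 (xE _)).
apply/xE => E SE; move: (h E SE); rewrite -(ext_ext Q WV VWX).
by move/(null_ext _ _ VV VWX (dS _ SE) pQe).
Qed.

(** The span of all outputs is taken as the intersection of the subspaces that contain them. The
    last clause is therefore an induction principle for vectors of [sp S P]. *)
Lemma spP (R : realType) (V W : {fset nat}) (S : sop R V -> Prop) (P : op R W) :
  (forall E, S E -> DProg E) -> is_proj P ->
  [/\ is_proj (sp S P),
      forall E v u, S E -> image (ext (V `|` W) P) v ->
        image (sp S P) (appv (sapp E (outer v v)) u) &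
      forall L, subspace L -> (forall E v u, S E -> image (ext (V `|` W) P) v ->
        L (appv (sapp E (outer v v)) u)) -> forall x, image (sp S P) x -> L x].
Proof.
move=> dS pP.
pose gen L := forall E v u, S E -> image (ext (V `|` W) P) v ->
  L (appv (sapp E (outer v v)) u).
have satE Q : is_proj Q -> sat_par S P Q <-> gen (image Q).
  move=> pQ; rewrite -[sat_par _ _ _]/(sat false S P Q).
  rewrite (@sat_nullP _ _ _ _ _ (V `|` W)) // ?ext_id //; last by fset_solve.
  split=> [h E v u SE Pv|h E SE v Pv]; first exact: (proj1 (null_parP _ (dS _ SE) pQ) (h E SE v Pv)).
  by apply/null_parP => //; [apply: dS | move=> u; apply: h].
have sub : subspace (fun x => forall L, subspace L -> gen L -> L x).
  split=> [L []//|c v w hv hw L sL gL].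
  by apply: (proj2 sL); [apply: hv | apply: hw].
have [Q0 [pQ0 Q0E]] := proj_exists sub.
pose smallest (Q : op R (V `|` W)) := [/\ is_proj Q, sat_par S P Q &
  forall Q', is_proj Q' -> sat_par S P Q' -> psub Q Q'].
have min0 : smallest Q0.
  split=> //; first by apply/satE => // E v u SE Pv; apply/Q0E => L sL; apply.
  by move=> Q' pQ' /(satE _ pQ') g x /Q0E; apply=> //; apply: image_subspace.
have [pX sX mX] : smallest (sp S P).
  exact (epsilon_spec (op_inhabited R (V `|` W)) smallest (ex_intro _ Q0 min0)).
split=> //; first exact/satE.
move=> L sL gL x xS; suff /Q0E : image Q0 x by apply.
by apply: mX xS => //; case: min0.
Qed.

Lemma sp_min (R : realType) (V W : {fset nat}) (S : sop R V -> Prop) (P : op R W) Q :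
  (forall E, S E -> DProg E) -> is_proj P ->
  (forall E v u, S E -> image (ext (V `|` W) P) v -> image Q (appv (sapp E (outer v v)) u)) ->
  psub (sp S P) Q.
Proof.
by move=> dS pP h x; have [_ _] := spP dS pP; apply=> //; apply: image_subspace.
Qed.

Lemma sp_ext (R : realType) (V W X : {fset nat}) (S : sop R V -> Prop) (P : op R W) E (v : vec R X) :
  (forall E, S E -> DProg E) -> is_proj P -> V `|` W `<=` X -> S E ->
  image (ext X P) v -> null false E (ext X (sp S P)) v.
Proof.
move=> dS pP VWX SE; have [pS gS _] := spP dS pP.
have WV : W `<=` V `|` W by fset_solve.
rewrite -(ext_ext P WV VWX) image_ext //; last exact: proj_ext.
move=> h; apply/null_ext => //; [by fset_solve | exact: dS | move=> s].
by apply/null_parP => //; [apply: dS | move=> u; apply: gS].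
Qed.

(** * Meets and joins of projectors, and their extensions *)

Lemma pmeetP (R : realType) (X : {fset nat}) (P Q : op R X) :
  is_proj (pmeet P Q) /\ forall v, image (pmeet P Q) v <-> image P v /\ image Q v.
Proof.
apply: (epsilon_spec (op_inhabited R X) _ (proj_exists _)).
split; first by split; apply: (proj1 (image_subspace _)).
by move=> c v w [v1 v2] [w1 w2]; split; apply: (proj2 (image_subspace _)).
Qed.

Lemma pjoinP (R : realType) (X : {fset nat}) (P Q : op R X) :
  is_proj (pjoin P Q) /\ forall v, image (pjoin P Q) v <->
    exists a b, image P a /\ image Q b /\ v = (fun s => a s + b s).
Proof.
apply: (epsilon_spec (op_inhabited R X) _ (proj_exists _)).
split.
  exists (fun=> 0), (fun=> 0); split; first exact: (proj1 (image_subspace _)).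
  split; first exact: (proj1 (image_subspace _)).
  by apply: vec_ext => s; rewrite addr0.
move=> c _ _ [a [b [Pa [Qb ->]]]] [a' [b' [Pa' [Qb' ->]]]].
exists (lincomb c a a'), (lincomb c b b'); split; first exact: (proj2 (image_subspace _)).
split; first exact: (proj2 (image_subspace _)).
by apply: vec_ext => s; rewrite /lincomb; ring.
Qed.

Lemma pjoin_lub (R : realType) (X : {fset nat}) (P Q M : op R X) :
  psub P M -> psub Q M -> psub (pjoin P Q) M.
Proof.
move=> PM QM v /(proj2 (pjoinP P Q))[a [b [/PM Ma [/QM Mb ->]]]].
rewrite (_ : (fun _ => _) = lincomb 1 a b); first exact: (proj2 (image_subspace _)).
by apply: vec_ext => s; rewrite /lincomb mul1r.
Qed.

Lemma psub_pjoinl (R : realType) (X : {fset nat}) (P Q : op R X) : psub P (pjoin P Q).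
Proof.
move=> v Pv; apply/(proj2 (pjoinP P Q)); exists v, (fun=> 0); split=> //.
split; first exact: (proj1 (image_subspace _)).
by apply: vec_ext => s; rewrite addr0.
Qed.

Lemma psub_pjoinr (R : realType) (X : {fset nat}) (P Q : op R X) : psub Q (pjoin P Q).
Proof.
move=> v Qv; apply/(proj2 (pjoinP P Q)); exists (fun=> 0), v; split.
  exact: (proj1 (image_subspace _)).
by split=> //; apply: vec_ext => s; rewrite add0r.
Qed.

Lemma null_mono (R : realType) b (V X : {fset nat}) (E : sop R V) (B D : op R X) v :
  V `<=` X -> DProg E -> is_proj B -> is_proj D -> psub B D -> null b E B v -> null b E D v.
Proof.
move=> VX dE pB pD BD.
have par : null false E B v -> null false E D v.
  by rewrite !null_parP // => h u; apply/BD/h.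
case: b => //; rewrite !null_totP // => -[h ?].
by split=> //; apply: par.
Qed.

Lemma null_meet (R : realType) b (V X : {fset nat}) (E : sop R V) (B D M : op R X) v :
  V `<=` X -> DProg E -> is_proj B -> is_proj D -> is_proj M ->
  (forall x, image M x <-> image B x /\ image D x) ->
  null b E M v <-> null b E B v /\ null b E D v.
Proof.
move=> VX dE pB pD pM ME.
have par : null false E M v <-> null false E B v /\ null false E D v.
  rewrite !null_parP //; split=> [h|[h1 h2] u]; last exact/ME.
  by split=> u; have /ME[] := h u.
by case: b => //; rewrite !null_totP //; tauto.
Qed.

Lemma image_ext_pmeet (R : realType) (U X : {fset nat}) (P Q : op R U) (v : vec R X) :
  U `<=` X -> is_proj P -> is_proj Q ->
  image (ext X (pmeet P Q)) v <-> image (ext X P) v /\ image (ext X Q) v.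
Proof.
move=> UX pP pQ; have [pM ME] := pmeetP P Q; rewrite !image_ext //; split=> [h|[h1 h2] s].
  by split=> s; have /ME[] := h s.
exact/ME.
Qed.

Lemma image_ext_prod (R : realType) (U X : {fset nat}) (P : op R U) (a : vec R U) (f : vec R X) :
  U `<=` X -> is_proj P -> image P a -> (forall (u : st U) s, f (join u s) = f s) ->
  image (ext X P) (fun s => a (restr U s) * f s).
Proof.
move=> UX pP Pa fj; apply/image_ext => // s.
rewrite (_ : slice U _ s = lincomb (f s) a (fun=> 0)).
  by apply: (proj2 (image_subspace _)) => //; apply: (proj1 (image_subspace _)).
by apply: vec_ext => u; rewrite /slice /lincomb restr_join // fj addr0 mulrC.
Qed.

Lemma agree_off_joinl (U X : {fset nat}) (u : st U) (s t : st X) :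
  agree_off U (join u s) t = agree_off U s t.
Proof.
by apply/agree_offP/agree_offP => h q qX qU; have := h q qX qU; rewrite memb_join qX (negbTE qU).
Qed.

(** The columns of the extended join are product vectors, and their factor on [U] splits into a
    vector of [P] and one of [Q]. *)
Lemma image_ext_pjoin (R : realType) (U X : {fset nat}) (P Q : op R U) (L : vec R X -> Prop) :
  U `<=` X -> is_proj P -> is_proj Q -> subspace L ->
  (forall v, image (ext X P) v -> L v) -> (forall v, image (ext X Q) v -> L v) ->
  forall v, image (ext X (pjoin P Q)) v -> L v.
Proof.
move=> UX pP pQ sL PL QL; apply: subspace_image => // t.
have /(proj2 (pjoinP P Q))[a [b [Pa [Qb abE]]]] := image_col (pjoin P Q) (restr U t).
pose f : vec R X := fun s => (agree_off U s t)%:R.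
have fj (u : st U) s : f (join u s) = f s by rewrite /f agree_off_joinl.
rewrite (_ : (fun _ => _) = lincomb 1 (fun s => a (restr U s) * f s) (fun s => b (restr U s) * f s)).
  by apply: (proj2 sL); [apply/PL/image_ext_prod | apply/QL/image_ext_prod].
apply: vec_ext => s; rewrite /lincomb mul1r -mulrDl; congr (_ * _).
exact: (congr1 (fun g => g (restr U s)) abE).
Qed.

(** * Tensor products *)

Lemma restr_join_disjoint (V Y X : {fset nat}) (u : st V) (s : st X) :
  Y `<=` X -> fdisjoint Y V -> restr Y (join u s) = restr Y s.
Proof. by move=> YX YV; rewrite restr_joinC // join_disjoint. Qed.

Lemma join_comm (V Y X : {fset nat}) (u : st V) (y : st Y) (s : st X) :
  fdisjoint Y V -> join u (join y s) = join y (join u s).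
Proof.
move=> /fdisjointP YV; apply: st_ext => q qX; rewrite !memb_join qX /=.
by have [/YV/negbTE -> //|_] := boolP (q \in Y).
Qed.

(** Only one intermediate state contributes: the one that is [t] on [X] and [s] on [Y]. *)
Lemma mulo_ext_disjoint (R : realType) (X Y Z : {fset nat}) (A : op R X) (B : op R Y) (s t : st Z) :
  Z = X `|` Y -> fdisjoint Y X ->
  mulo (ext Z A) (ext Z B) s t =
  A (restr X s) (restr X t) * B (restr Y s) (restr Y t).
Proof.
move=> defZ YX; have XZ : X `<=` Z by rewrite defZ fsubsetUl.
have YZ : Y `<=` Z by rewrite defZ fsubsetUr.
rewrite mulo_ext // -[RHS](sum_delta (restr X t)
  (fun u => A (restr X s) u * B (restr Y s) (restr Y t))).
apply: eq_bigr => u _; rewrite /ext restr_join_disjoint // [RHS]mulrC -mulrA.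
congr (_ * (_ * (nat_of_bool _)%:R)).
apply/agree_offP/eqP => [h|<- q qZ qY].
  apply: st_ext => q qX; have qZ := fsubsetP XZ q qX.
  have qY : q \notin Y by apply: contraL qX => /(fdisjointP YX).
  by have := h q qZ qY; rewrite memb_join memb_restr qZ qX.
have qX : q \in X by move: qZ; rewrite defZ inE (negbTE qY) orbF.
by rewrite memb_join memb_restr qZ qX.
Qed.

Lemma tensE (R : realType) (X Y : {fset nat}) (A : op R X) (B : op R Y) :
  fdisjoint Y X -> tens A B = mulo (ext (X `|` Y) A) (ext (X `|` Y) B).
Proof. by move=> YX; apply: op_ext => s t; rewrite mulo_ext_disjoint. Qed.

Lemma tensEC (R : realType) (X Y : {fset nat}) (A : op R X) (B : op R Y) :
  fdisjoint Y X -> tens A B = mulo (ext (X `|` Y) B) (ext (X `|` Y) A).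
Proof.
move=> YX; have XY : fdisjoint X Y by rewrite fdisjoint_sym.
by apply: op_ext => s t; rewrite (mulo_ext_disjoint _ _ _ _ (fsetUC X Y) XY) mulrC.
Qed.

(** By [tensE] and [tensEC] the tensor product is a product of two commuting projectors. *)
Lemma proj_tens (R : realType) (X Y : {fset nat}) (P : op R X) (T : op R Y) :
  fdisjoint Y X -> is_proj P -> is_proj T -> is_proj (tens P T).
Proof.
move=> YX pP pT.
have [PP aP] : is_proj (ext (X `|` Y) P) by apply: proj_ext; rewrite ?fsubsetUl.
have [TT aT] : is_proj (ext (X `|` Y) T) by apply: proj_ext; rewrite ?fsubsetUr.
split; last by rewrite {1}tensE // tensEC // adj_mulo aP aT.
by rewrite {1}tensEC // tensE // -muloA [mulo (ext _ P) (mulo _ _)]muloA PP -tensE // tensEC // muloA TT.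
Qed.

Lemma image_ext_tens (R : realType) (X Y Z : {fset nat}) (P : op R X) (T : op R Y) (v : vec R Z) :
  fdisjoint Y X -> is_proj P -> is_proj T -> X `|` Y `<=` Z ->
  image (ext Z (tens P T)) v <-> image (ext Z P) v /\ image (ext Z T) v.
Proof.
move=> YX pP pT XYZ.
have XU : X `<=` X `|` Y by rewrite fsubsetUl.
have YU : Y `<=` X `|` Y by rewrite fsubsetUr.
have pPe := proj_ext XU pP; have pTe := proj_ext YU pT; have pPT := proj_tens YX pP pT.
rewrite -(ext_ext P XU XYZ) -(ext_ext T YU XYZ) !image_ext //.
have key (w : vec R (X `|` Y)) : image (tens P T) w <-> image (ext _ P) w /\ image (ext _ T) w.
  split=> [[x ->]|[/(proj_imageP _ pPe) Pw /(proj_imageP _ pTe) Tw]].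
    split; first by rewrite tensE // appv_mulo; apply: image_appv.
    by rewrite tensEC // appv_mulo; apply: image_appv.
  by apply/proj_imageP => //; rewrite tensE // appv_mulo Tw Pw.
split=> [h|[h1 h2] s]; last exact/key.
by split=> s; have /key[] := h s.
Qed.

Lemma sop_linear0 (R : realType) (V : {fset nat}) (E : sop R V) :
  sop_linear E -> E (zop R V) = zop R V.
Proof.
move=> lE; have := lE (-1) (zop R V) (zop R V).
rewrite (_ : (fun _ _ => -1 * zop R V _ _ + _) = zop R V).
  by move=> ->; apply: op_ext => u w; rewrite mulN1r addNr.
by apply: op_ext => u w; rewrite /zop mulr0 addr0.
Qed.

Lemma sop_linear_scale (R : realType) (V : {fset nat}) (E : sop R V) c (A : op R V) :
  sop_linear E -> E (fun u w => c * A u w) = fun u w => c * E A u w.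
Proof.
move=> lE; have := lE c A (zop R V); rewrite sop_linear0 // /zop.
rewrite (_ : (fun _ _ => c * A _ _ + 0) = fun u w => c * A u w).
  by move=> ->; apply: op_ext => u w; rewrite addr0.
by apply: op_ext => u w; rewrite addr0.
Qed.

Lemma sop_linear_sum (R : realType) (V : {fset nat}) (J : finType) (E : sop R V)
    (c : J -> R[i]) (A : J -> op R V) :
  sop_linear E ->
  E (fun u w => \sum_j c j * A j u w) = fun u w => \sum_j c j * E (A j) u w.
Proof.
move=> lE; elim: (index_enum J) => [|j r IH].
  rewrite (_ : (fun _ _ => _) = zop R V); last by apply: op_ext => u w; rewrite big_nil.
  by rewrite sop_linear0 //; apply: op_ext => u w; rewrite big_nil.
rewrite (_ : (fun _ _ => _) = fun u w => c j * A j u w + \sum_(k <- r) c k * A k u w).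
  by rewrite lE IH; apply: op_ext => u w; rewrite big_cons.
by apply: op_ext => u w; rewrite big_cons.
Qed.

(** Multiplication by [B] is a linear combination of operators differing only in qubits of [Y],
    which [E] does not touch, so linearity of [E] suffices. *)
Lemma sapp_mulo_ext (R : realType) (V Y X : {fset nat}) (E : sop R V) (B : op R Y) (A : op R X) :
  sop_linear E -> V `<=` X -> Y `<=` X -> fdisjoint Y V ->
  sapp E (mulo (ext X B) A) = mulo (ext X B) (sapp E A).
Proof.
move=> lE VX YX YV; have VY : fdisjoint V Y by rewrite fdisjoint_sym.
apply: op_ext => s t; rewrite mulo_ext // /sapp.
pose F y := fun u w : st V => A (join u (@join Y X y s)) (join w t).
rewrite (_ : (fun u w => _) = fun u w => \sum_y B (restr Y s) y * F y u w).
  by rewrite sop_linear_sum //; apply: eq_bigr => y _; rewrite restr_join_disjoint.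
apply: op_ext => u w; rewrite mulo_ext // restr_join_disjoint //.
by apply: eq_bigr => y _; rewrite /F join_comm.
Qed.

Lemma sapp_outer_ext (R : realType) (V Y X : {fset nat}) (E : sop R V) (B : op R Y) (v w : vec R X) :
  sop_linear E -> V `<=` X -> Y `<=` X -> fdisjoint Y V ->
  sapp E (outer (appv (ext X B) v) w) = mulo (ext X B) (sapp E (outer v w)).
Proof. by move=> *; rewrite -mulo_outer sapp_mulo_ext. Qed.

(** From [T v = v] follows [E(|v><v|) = T E(|v><v|)], whose range is in the image of [T]. *)
Lemma null_disjoint (R : realType) (V Y X : {fset nat}) (E : sop R V) (T : op R Y) (v : vec R X) :
  DProg E -> V `<=` X -> Y `<=` X -> fdisjoint Y V -> is_proj T ->
  image (ext X T) v -> null false E (ext X T) v.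
Proof.
move=> dE VX YX YV pT; have pTe := proj_ext YX pT; have [lE _ _] := dE.
move=> /(proj_imageP _ pTe) Tv; apply/null_parP => // u.
by rewrite -{1}Tv sapp_outer_ext // appv_mulo; apply: image_appv.
Qed.

(* Trace preservation on [v] makes [v] a null vector of [tr - tr \o E], hence
   [<v|T v> = tr (E |T v><v|) = tr (T (E |v><v|)) = <v|v>], so that [T v = v]. *)
Lemma null_tot_disjoint (R : realType) (V Y X : {fset nat}) (E : sop R V) (T : op R Y) (v : vec R X) :
  DProg E -> V `<=` X -> Y `<=` X -> fdisjoint Y V -> is_proj T ->
  null true E (ext X T) v -> image (ext X T) v.
Proof.
move=> dE VX YX YV pT; have pTe := proj_ext YX pT; have [lE cE tE] := dE.
move=> /(null_totP _ VX dE pTe)[/(null_parP _ dE pTe) TE trv].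
pose h (A : op R X) := tr A - tr (sapp E A).
have lh : linear_form h.
  by move=> c A B; rewrite /h sapp_linear // !tr_linear; ring.
have h0 w : 0 <= h (outer w w) by rewrite subr_ge0 tr_sapp_le //; apply: psd_outer.
have hv : h (outer v v) = 0 by rewrite /h trv subrr.
have [_ /(_ (appv (ext X T) v))] := linear_form_null lh h0 hv.
rewrite /h sapp_outer_ext // (_ : mulo _ (sapp E _) = sapp E (outer v v)); last first.
  apply: op_ext => s t; have /(proj_imageP _ pTe) := TE (fun u => (t == u)%:R).
  by rewrite appv_ket => /(congr1 (fun f => f s)).
move/subr0_eq; rewrite trv -mulo_outer => trT.
have := tr_compl (ext X T) (outer v v); rewrite trT subrr mulo_outer.
rewrite tr_outer_proj; last exact: proj_compl.
move=> /tr_outer_eq0; rewrite appv_compl => c0; exists v; apply: vec_ext => s.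
by have /eqP := congr1 (fun f => f s) c0; rewrite subr_eq0 => /eqP.
Qed.

Definition vtens (R : realType) (A B : {fset nat}) (x : vec R A) (y : vec R B) : vec R (A `|` B) :=
  fun s => x (restr A s) * y (restr B s).

(** The output on a product input is [E(|v><v|)] tensored with [|y><y|]. Testing it against [u]
    tensored with a basis state of [B] leaves one coefficient of [y], conjugated. *)
Lemma sapp_vtens (R : realType) (V A B : {fset nat}) (E : sop R V) (v u : vec R A) (y : vec R B) t0 :
  sop_linear E -> V `<=` A -> fdisjoint B A ->
  appv (sapp E (outer (vtens v y) (vtens v y)))
    (fun t => u (restr A t) * (agree_off A t0 t)%:R) =
  fun s => (y (restr B t0))^* * vtens (appv (sapp E (outer v v)) u) y s.
Proof.
move=> lE VA BA.
have AX : A `<=` A `|` B by rewrite fsubsetUl.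
have BX : B `<=` A `|` B by rewrite fsubsetUr.
have BV : fdisjoint B V by apply: fdisjointWr BA.
apply: vec_ext => s; rewrite /appv.
under eq_bigr do rewrite mulrA.
rewrite (sum_agree_off _ (fun t => _ * u (restr A t))) // /vtens /appv mulr_suml mulr_sumr.
apply: eq_bigr => a _; rewrite restr_join // /sapp.
rewrite (_ : (fun b c => outer (vtens v y) (vtens v y) _ _) = fun b c =>
    y (restr B s) * (y (restr B t0))^* * outer v v (join b (restr A s)) (join c a)).
  rewrite sop_linear_scale // !restr_restr // restr_join_sub //.
  by ring.
apply: op_ext => b c; rewrite /outer /vtens !(restr_join_disjoint _ _ BX BV).
rewrite (restr_join_disjoint _ _ BX BA) !restr_joinC // join_full.
by rewrite rmorphM /=; ring.
Qed.

(** * Laws of the transformers *)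

Lemma ext_zop (R : realType) (U X : {fset nat}) : ext X (zop R U) = zop R X.
Proof. by apply: op_ext => s t; rewrite /ext /zop mul0r. Qed.

Lemma ple_psub (R : realType) (X Y U : {fset nat}) (P : op R X) (Q : op R Y) :
  X `<=` U -> Y `<=` U -> U `<=` X `|` Y -> is_proj P -> is_proj Q ->
  psub (ext U P) (ext U Q) -> ple P Q.
Proof.
move=> XU YU UXY pP pQ PQ; rewrite /ple -(ext_ext P XU UXY) -(ext_ext Q YU UXY).
by apply: psub_ext => //; apply: proj_ext.
Qed.

Lemma ple_anti (R : realType) (X Y : {fset nat}) (P : op R X) (Q : op R Y) :
  is_proj P -> is_proj Q -> ple P Q -> ple Q P -> peq P Q.
Proof.
rewrite /ple /peq fsetUC => pP pQ PQ QP.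
by apply: proj_anti => //; apply: proj_ext => //; fset_solve.
Qed.

Lemma sp_wlp_le (R : realType) (V W : {fset nat}) (S : sop R V -> Prop) (Q : op R W) :
  (forall E, S E -> DProg E) -> is_proj Q -> ple (sp S (wlp S Q)) Q.
Proof.
move=> dS pQ; have [pX _] := xpP false dS pQ; have [pS _ _] := spP dS pX.
apply: (@ple_psub _ _ _ (V `|` (V `|` W))) => //; try fset_solve; rewrite ext_id.
have VW : V `|` W `<=` V `|` (V `|` W) by fset_solve.
apply: sp_min => // E v u SE /(xp_ext false _ dS pQ VW)/(_ E SE)/null_parP; apply.
  exact: dS.
by apply: proj_ext => //; fset_solve.
Qed.

Lemma wlp_sp_ge (R : realType) (V W : {fset nat}) (S : sop R V -> Prop) (P : op R W) :
  (forall E, S E -> DProg E) -> is_proj P -> ple P (wlp S (sp S P)).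
Proof.
move=> dS pP v Pv; have [pS _ _] := spP dS pP.
apply/(xp_ext false _) => //; first by fset_solve.
by move=> E SE; apply: sp_ext => //; fset_solve.
Qed.

Lemma wp_wlp (R : realType) (V W : {fset nat}) (S : sop R V -> Prop) (Q : op R W) :
  (forall E, S E -> DProg E) -> is_proj Q ->
  wp S Q = pmeet (wlp S Q) (wp S (idop R W)).
Proof.
move=> dS pQ; have [pX XE] := xpP true dS pQ; have [_ LE] := xpP false dS pQ.
have [_ IE] := xpP true dS (proj_idop R W); have [pM ME] := pmeetP (wlp S Q) (wp S (idop R W)).
have VW : V `<=` V `|` W by fset_solve.
have WW : W `<=` V `|` W by fset_solve.
have pQe := proj_ext WW pQ.
apply: proj_eq => // v; rewrite ME XE LE IE ext_idop //.
split=> [h|[h1 h2] E SE].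
  split=> E SE; have /(null_totP _ VW (dS _ SE) pQe)[hn ht] := h E SE => //.
  by apply/(null_totP _ VW (dS _ SE) (proj_idop _ _)); split=> //; apply/null_idop/dS.
apply/(null_totP _ VW (dS _ SE) pQe); split; first exact: h1.
by have /(null_totP _ VW (dS _ SE) (proj_idop _ _))[] := h2 E SE.
Qed.

(** A member of [S] must send [|v><v|] to zero and yet preserve its trace, so [v] is zero. *)
Lemma wp_zop (R : realType) (V W : {fset nat}) (S : sop R V -> Prop) :
  (exists E, S E) -> (forall E, S E -> DProg E) -> wp S (zop R W) = zop R (V `|` W).
Proof.
move=> [E SE] dS; have [pX XE] := xpP true dS (proj_zop R W).
have VW : V `<=` V `|` W by fset_solve.
apply: proj_anti => //; first exact: proj_zop; last first.
  by move=> v /image_zop ->; apply: (proj1 (image_subspace _)).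
move=> v /XE/(_ E SE); rewrite ext_zop => /(null_totP _ VW (dS _ SE) (proj_zop _ _))[].
move=> /(null_parP _ (dS _ SE) (proj_zop _ _)) h trv.
suff -> : v = fun=> 0 by apply: (proj1 (image_subspace _)).
apply: tr_outer_eq0; rewrite -trv; apply: big1 => s _.
have /image_zop := h (fun u => (s == u)%:R).
by rewrite appv_ket => /(congr1 (fun f => f s)).
Qed.

Lemma sp_zop (R : realType) (V W : {fset nat}) (S : sop R V -> Prop) :
  (forall E, S E -> DProg E) -> sp S (zop R W) = zop R (V `|` W).
Proof.
move=> dS; have [pS _ _] := spP dS (proj_zop R W).
apply: proj_anti => //; first exact: proj_zop; last first.
  by move=> v /image_zop ->; apply: (proj1 (image_subspace _)).
apply: sp_min => // [|E v u SE]; first exact: proj_zop.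
rewrite ext_zop => /image_zop ->.
rewrite (_ : outer _ _ = zop R _); last by apply: op_ext => s t; rewrite /outer mul0r.
exists (fun=> 0); rewrite appv0; apply: vec_ext => s; apply: big1 => t _.
rewrite /sapp (_ : E _ = zop R V) ?mul0r //.
by apply: sop_linear0; case: (dS E SE).
Qed.

Lemma wlp_idop (R : realType) (V W : {fset nat}) (S : sop R V -> Prop) :
  (forall E, S E -> DProg E) -> wlp S (idop R W) = idop R (V `|` W).
Proof.
move=> dS; have [pX XE] := xpP false dS (proj_idop R W).
apply: proj_eq => //; first exact: proj_idop.
move=> v; split=> _; first exact: image_idop.
by apply/XE => E SE; rewrite ext_idop; [apply/null_idop/dS | fset_solve].
Qed.

Lemma xp_mono (R : realType) b (V W : {fset nat}) (S : sop R V -> Prop) (P Q : op R W) :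
  (forall E, S E -> DProg E) -> is_proj P -> is_proj Q -> psub P Q ->
  psub (xp b S P) (xp b S Q).
Proof.
move=> dS pP pQ PQ; have [_ PE] := xpP b dS pP; have [_ QE] := xpP b dS pQ.
have WW : W `<=` V `|` W by fset_solve.
move=> v /PE h; apply/QE => E SE; apply: null_mono (h E SE); rewrite ?fsubsetUl //.
- exact: dS.
- exact: proj_ext.
- exact: proj_ext.
- exact: psub_ext.
Qed.

Lemma sp_mono (R : realType) (V W : {fset nat}) (S : sop R V -> Prop) (P Q : op R W) :
  (forall E, S E -> DProg E) -> is_proj P -> is_proj Q -> psub P Q ->
  psub (sp S P) (sp S Q).
Proof.
move=> dS pP pQ PQ; have [_ gQ _] := spP dS pQ.
apply: sp_min => // E v u SE Pv; apply: gQ => //; move: Pv.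
by apply: psub_ext => //; fset_solve.
Qed.

Lemma xp_pmeet (R : realType) b (V W : {fset nat}) (S : sop R V -> Prop) (P Q : op R W) :
  (forall E, S E -> DProg E) -> is_proj P -> is_proj Q ->
  xp b S (pmeet P Q) = pmeet (xp b S P) (xp b S Q).
Proof.
move=> dS pP pQ; have [_ PE] := xpP b dS pP; have [_ QE] := xpP b dS pQ.
have [pM _] := pmeetP P Q; have [pX ME] := xpP b dS pM.
have [pXM XME] := pmeetP (xp b S P) (xp b S Q).
have WW : W `<=` V `|` W by fset_solve.
have key E v : S E -> null b E (ext (V `|` W) (pmeet P Q)) v <->
    null b E (ext (V `|` W) P) v /\ null b E (ext (V `|` W) Q) v.
  move=> SE; apply: null_meet; rewrite ?fsubsetUl //; try exact: proj_ext.
    exact: dS.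
  by move=> x; apply: image_ext_pmeet.
apply: proj_eq => // v; rewrite ME XME PE QE.
split=> [h|[h1 h2] E SE]; first by split=> E SE; have /(key _ _ SE)[] := h E SE.
by apply/key => //; split; [apply: h1 | apply: h2].
Qed.

Lemma sp_pjoin (R : realType) (V W : {fset nat}) (S : sop R V -> Prop) (P Q : op R W) :
  (forall E, S E -> DProg E) -> is_proj P -> is_proj Q ->
  pjoin (sp S P) (sp S Q) = sp S (pjoin P Q).
Proof.
move=> dS pP pQ; have [pJ _] := pjoinP P Q; have [pS _ _] := spP dS pJ.
have [pSJ _] := pjoinP (sp S P) (sp S Q).
have [_ gP _] := spP dS pP; have [_ gQ _] := spP dS pQ.
apply: proj_anti => //.
  apply: pjoin_lub; apply: sp_mono => //; [exact: psub_pjoinl | exact: psub_pjoinr].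
apply: sp_min => // E v u SE Jv.
(* The outputs are quadratic in [v], so a sum of inputs cannot be split directly. The inputs whose
   outputs stay in the join do form a subspace, and it contains the images of [P] and of [Q]. *)
apply: (proj1 (null_parP _ (dS _ SE) pSJ)); move: v Jv.
apply: image_ext_pjoin; rewrite ?fsubsetUr //.
- by apply: null_subspace => //; [exact: fsubsetUl | exact: dS].
- move=> v Pv; apply/(null_parP _ (dS _ SE) pSJ) => w; apply: psub_pjoinl; exact: gP.
- move=> v Qv; apply/(null_parP _ (dS _ SE) pSJ) => w; apply: psub_pjoinr; exact: gQ.
Qed.

(** Inputs in the image of [T] have outputs with range there, by [null_disjoint]. For total
    correctness the trace condition known for [Q] is the very one required for [T]. *)
Lemma xp_tens_ge (R : realType) b (V W W' : {fset nat}) (S : sop R V -> Prop) (Q : op R W)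
    (T : op R W') :
  (forall E, S E -> DProg E) -> is_proj Q -> is_proj T -> fdisjoint W' (V `|` W) ->
  ple (tens (xp b S Q) T) (xp b S (tens Q T)).
Proof.
move=> dS pQ pT dis; have [pX XE] := xpP b dS pQ.
have dW : fdisjoint W' W by apply: fdisjointWr dis; fset_solve.
have dV : fdisjoint W' V by apply: fdisjointWr dis; fset_solve.
have pQT := proj_tens dW pQ pT; set Z := (V `|` W `|` W') `|` (V `|` (W `|` W')).
move=> v /image_ext_tens; rewrite -/Z => /(_ dis pX pT)[]; first by rewrite /Z; fset_solve.
move=> /xp_ext -/(_ dS pQ) h Tv; apply/xp_ext => //; first by rewrite /Z; fset_solve.
move=> E SE; have dE := dS E SE.
have VZ : V `<=` Z by rewrite /Z; fset_solve.
have WZ : W `<=` Z by rewrite /Z; fset_solve.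
have WZ' : W' `<=` Z by rewrite /Z; fset_solve.
have pQZ := proj_ext WZ pQ; have pTZ := proj_ext WZ' pT.
have pQTZ : is_proj (ext Z (tens Q T)) by apply: proj_ext => //; rewrite /Z; fset_solve.
have {}h : null b E (ext Z Q) v by apply: h => //; rewrite /Z; fset_solve.
have nT := null_disjoint dE VZ WZ' dV pT Tv.
apply/(null_meet _ _ VZ dE pQZ pTZ pQTZ); last first.
  split=> //; case: (b) h => // /(null_totP _ VZ dE pQZ)[_ ht].
  by apply/(null_totP _ VZ dE pTZ).
by move=> x; apply: image_ext_tens => //; rewrite /Z; fset_solve.
Qed.

(** Trace preservation allows [null_tot_disjoint] to recover that the input lies in the image of
    [T]. The partial analogue fails: the zero program makes every input null. *)
Lemma wp_tens_le (R : realType) (V W W' : {fset nat}) (S : sop R V -> Prop) (Q : op R W)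
    (T : op R W') :
  (exists E, S E) -> (forall E, S E -> DProg E) -> is_proj Q -> is_proj T ->
  fdisjoint W' (V `|` W) -> ple (wp S (tens Q T)) (tens (wp S Q) T).
Proof.
move=> [E0 SE0] dS pQ pT dis; have [pX XE] := xpP true dS pQ.
have dW : fdisjoint W' W by apply: fdisjointWr dis; fset_solve.
have dV : fdisjoint W' V by apply: fdisjointWr dis; fset_solve.
have pQT := proj_tens dW pQ pT; set Z := (V `|` (W `|` W')) `|` (V `|` W `|` W').
have VZ : V `<=` Z by rewrite /Z; fset_solve.
have WZ : W `<=` Z by rewrite /Z; fset_solve.
have WZ' : W' `<=` Z by rewrite /Z; fset_solve.
have pQZ := proj_ext WZ pQ; have pTZ := proj_ext WZ' pT.
have pQTZ : is_proj (ext Z (tens Q T)) by apply: proj_ext => //; rewrite /Z; fset_solve.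
move=> v /(xp_ext true) -/(_ dS pQT) h.
have {}h E : S E -> null true E (ext Z Q) v /\ null true E (ext Z T) v.
  move=> SE; apply/(null_meet _ _ VZ (dS _ SE) pQZ pTZ pQTZ).
    by move=> x; apply: image_ext_tens => //; rewrite /Z; fset_solve.
  by apply: h => //; rewrite /Z; fset_solve.
apply/image_ext_tens => //; rewrite -/Z; first by rewrite /Z; fset_solve.
split; last exact: null_tot_disjoint (dS _ SE0) VZ WZ' dV pT (proj2 (h _ SE0)).
by apply/(xp_ext true _) => //; [rewrite /Z; fset_solve | move=> E /h[]].
Qed.

(** Each generating output lies in the image of [sp S P] by [sp_ext] and in that of [T] by
    [null_disjoint]. *)
Lemma sp_tens_le (R : realType) (V W W' : {fset nat}) (S : sop R V -> Prop) (P : op R W)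
    (T : op R W') :
  (forall E, S E -> DProg E) -> is_proj P -> is_proj T -> fdisjoint W' (V `|` W) ->
  ple (sp S (tens P T)) (tens (sp S P) T).
Proof.
move=> dS pP pT dis; have [pS gS _] := spP dS pP.
have dW : fdisjoint W' W by apply: fdisjointWr dis; fset_solve.
have dV : fdisjoint W' V by apply: fdisjointWr dis; fset_solve.
have pPT := proj_tens dW pP pT; have pST := proj_tens dis pS pT.
have [pSPT _ _] := spP dS pPT; set Y := V `|` (W `|` W').
have sub : V `|` W `|` W' `<=` Y by rewrite /Y; fset_solve.
apply: (@ple_psub _ _ _ Y) => //; try by rewrite /Y; fset_solve.
rewrite ext_id; apply: sp_min => // E v u SE.
move=> /image_ext_tens -/(_ dW pP pT)[]; first by fset_solve.
move=> Pv Tv; have dE := dS E SE.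
have VY : V `<=` Y by rewrite /Y; fset_solve.
have WY' : W' `<=` Y by rewrite /Y; fset_solve.
apply/image_ext_tens => //; split.
  apply: (proj1 (null_parP _ dE _)); first by apply: proj_ext => //; rewrite /Y; fset_solve.
  by apply: sp_ext => //; rewrite /Y; fset_solve.
apply: (proj1 (null_parP _ dE (proj_ext WY' pT))).
exact: null_disjoint.
Qed.

(* For a fixed [y] in the image of [T], the vectors [x] with [x (x) y] in the image of
   [sp S (tens P T)] form a subspace that contains the generators of [sp S P]. *)
Lemma sp_tens_ge (R : realType) (V W W' : {fset nat}) (S : sop R V -> Prop) (P : op R W)
    (T : op R W') :
  (forall E, S E -> DProg E) -> is_proj P -> is_proj T -> fdisjoint W' (V `|` W) ->
  ple (tens (sp S P) T) (sp S (tens P T)).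
Proof.
move=> dS pP pT dis; have [pS gS mS] := spP dS pP.
have dW : fdisjoint W' W by apply: fdisjointWr dis; fset_solve.
have pPT := proj_tens dW pP pT; have pST := proj_tens dis pS pT.
have [pSPT _ _] := spP dS pPT; set A := V `|` W; set Z := A `|` W'.
have VA : V `<=` A by rewrite /A fsubsetUl.
have WA : W `<=` A by rewrite /A fsubsetUr.
have AZ : A `<=` Z by rewrite /Z fsubsetUl.
have WZ' : W' `<=` Z by rewrite /Z fsubsetUr.
have sub : V `|` (W `|` W') `<=` Z by rewrite /Z /A; fset_solve.
set M := ext Z (sp S (tens P T)); have pM : is_proj M by apply: proj_ext.
have sM : subspace (image M) by apply: image_subspace.
apply: (@ple_psub _ _ _ Z) => //; try by rewrite /Z /A; fset_solve.
rewrite ext_id; apply: subspace_image => // t.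
suff key y : image T y -> forall x, image (sp S P) x -> image M (vtens x y).
  (* A column of the tensor product is the product of a column of [sp S P] and one of [T]. *)
  by apply: (key (T^~ (restr W' t)) _ ((sp S P)^~ (restr A t))); apply: image_col.
move=> Ty; apply: mS.
  split=> [|c v w hv hw].
    rewrite (_ : vtens _ _ = fun=> 0); first by case: sM.
    by apply: vec_ext => s; rewrite /vtens mul0r.
  rewrite (_ : vtens _ _ = lincomb c (vtens v y) (vtens w y)); first by apply: (proj2 sM).
  by apply: vec_ext => s; rewrite /vtens /lincomb; ring.
move=> E v u SE Pv; have [lE _ _] := dS E SE.
have [[b0 yb0]|y0] := classic (exists b0, y b0 != 0); last first.
  rewrite (_ : vtens _ _ = fun=> 0); first by case: sM.
  apply: vec_ext => s; rewrite /vtens; have [->|yn] := eqVneq (y (restr W' s)) 0.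
    by rewrite mulr0.
  by case: y0; exists (restr W' s).
(* Only the [W'] part of [t0] matters: it selects the nonzero coefficient [y b0], so the scalar in
   [sapp_vtens] can be inverted. *)
pose t0 : st Z := join b0 set0; have t0E : restr W' t0 = b0 by rewrite /t0 restr_join.
have vE := sapp_vtens v u y t0 lE VA dis; rewrite t0E in vE.
rewrite (_ : vtens (appv (sapp E (outer v v)) u) y = lincomb ((y b0)^*)^-1
    (fun s => (y b0)^* * vtens (appv (sapp E (outer v v)) u) y s) (fun=> 0)); last first.
  by apply: vec_ext => s; rewrite /lincomb addr0 mulrA mulVf ?mul1r // conjC_eq0.
apply: (proj2 sM); last by case: sM.
(* The rescaled vector is an output of [E] on the product input [vtens v y], which lies in the
   images of both [P] and [T]. *)
rewrite -vE; apply: (proj1 (null_parP _ (dS _ SE) pM)).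
apply: sp_ext => //; apply/image_ext_tens => //; first by rewrite /Z /A; fset_solve.
split.
  rewrite -(ext_ext P WA AZ); apply: image_ext_prod => //; first exact: proj_ext.
  by move=> a s; rewrite restr_join_disjoint.
rewrite (_ : vtens v y = fun s => y (restr W' s) * v (restr A s)); last first.
  by apply: vec_ext => s; rewrite mulrC.
apply: image_ext_prod => // a s.
by rewrite restr_join_disjoint // fdisjoint_sym.
Qed.

Theorem theorem5p6 (R : realType) (V : {fset nat}) (E : sop R V -> Prop)
  (W : {fset nat}) (P Q : op R W) :
  NProg E -> is_proj P -> is_proj Q ->
  (* (1) *)
  (ple (sp E (wlp E Q)) Q /\ ple P (wlp E (sp E P))) /\
  (* (2) *)
  wp E Q = pmeet (wlp E Q) (wp E (idop R W)) /\
  (* (3) *)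
  (wp E (zop R W) = zop R (V `|` W) /\ sp E (zop R W) = zop R (V `|` W) /\
   peq (wlp E (idop R W)) (idop R W)) /\
  (* (4) *)
  (psub P Q ->
     psub (wp E P) (wp E Q) /\ psub (wlp E P) (wlp E Q) /\ psub (sp E P) (sp E Q)) /\
  (* (5) *)
  (wp E (pmeet P Q) = pmeet (wp E P) (wp E Q) /\
   wlp E (pmeet P Q) = pmeet (wlp E P) (wlp E Q)) /\
  (* (6) *)
  psub (sp E (pmeet P Q)) (pmeet (sp E P) (sp E Q)) /\
  (* (7) *)
  (psub (pjoin (wp E P) (wp E Q)) (wp E (pjoin P Q)) /\
   psub (pjoin (wlp E P) (wlp E Q)) (wlp E (pjoin P Q))) /\
  (* (8) *)
  pjoin (sp E P) (sp E Q) = sp E (pjoin P Q) /\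
  (* (9) *)
  (forall (W' : {fset nat}) (Rr : op R W'), is_proj Rr -> fdisjoint W' (V `|` W) ->
     peq (wp E (tens Q Rr)) (tens (wp E Q) Rr) /\
     peq (sp E (tens P Rr)) (tens (sp E P) Rr) /\
     ple (tens (wlp E Q) Rr) (wlp E (tens Q Rr))).
Proof.
move=> [neE dE _ _] pP pQ.
have [pM ME] := pmeetP P Q; have [pJ _] := pjoinP P Q.
have MP : psub (pmeet P Q) P by move=> v /ME[].
have MQ : psub (pmeet P Q) Q by move=> v /ME[].
have join_xp b : psub (pjoin (xp b E P) (xp b E Q)) (xp b E (pjoin P Q)).
  by apply: pjoin_lub; apply: xp_mono => //; [apply: psub_pjoinl | apply: psub_pjoinr].
split; first by split; [apply: sp_wlp_le | apply: wlp_sp_ge].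
split; first exact: wp_wlp.
split.
  split; first exact: wp_zop.
  split; first exact: sp_zop.
  by rewrite /peq wlp_idop // !ext_idop //; fset_solve.
split=> [PQ|].
  by split; [apply: (xp_mono (b := true)) | split; [apply: (xp_mono (b := false)) | apply: sp_mono]].
split; first by split; [apply: (xp_pmeet true) | apply: (xp_pmeet false)].
split=> [v Sv|]; first by apply/(proj2 (pmeetP _ _)); split; apply: sp_mono Sv.
split; first by split; [apply: (join_xp true) | apply: (join_xp false)].
split; first exact: sp_pjoin.
move=> W' T pT dis; have dW : fdisjoint W' W by apply: fdisjointWr dis; fset_solve.
split.
  apply: ple_anti.
  - by have [] := xpP true dE (proj_tens dW pQ pT).
  - by apply: proj_tens => //; have [] := xpP true dE pQ.
  - exact: wp_tens_le.
  - exact: (xp_tens_ge (b := true)).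
split; last exact: (xp_tens_ge (b := false)).
apply: ple_anti.
- by have [] := spP dE (proj_tens dW pP pT).
- by apply: proj_tens => //; have [] := spP dE pP.
- exact: sp_tens_le.
- exact: sp_tens_ge.
Qed.
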